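(* Let $k$ be a fixed field and let $n,a,b,c$ be positive integers. Let $D(n,a,b,c)$ denote the set of all connected graded $k$-algebras $A$ with at most $n$ generators such that $m_1(A)\le a$, $m_2(A)\le b$ and $m_3(A)\le c$. Then the set of Hilbert series $\{A(z) : A\in D(n,a,b,c)\}$ is finite.
   Context: A connected graded algebra over $k$ is an associative algebra $A=\bigoplus_{i\ge 0}A_i$ with $A_0=k$. The trivial module $k=A/\bigoplus_{i\ge1}A_i$ is graded, so each $\mathrm{Tor}_i^A(k,k)$ is a graded vector space; its degree $j$ component is $\mathrm{Tor}_i^A(k,k)_j$. Put $m_i(A)=\sup\{j \mid \mathrm{Tor}_i^A(k,k)_j\ne 0\}$, with $m_i(A)=0$ if $\mathrm{Tor}_i^A(k,k)=0$. Thus $m_1(A)$ is the exact bound for the degrees of minimal homogeneous generators of $A$, and $m_2(A)$ is the exact bound for the degrees of minimal homogeneous relations of $A$. The Hilbert series of a locally finite graded vector space $V$ is $V(z)=\sum_i(\dim_k V_i)z^i$. *)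

(* Defs.v *)
From HB Require Import structures.
From mathcomp Require Import all_boot all_order all_algebra.
From mathcomp Require Import finmap.
From mathcomp Require Import boolp classical_sets cardinality constructive_ereal.
(* The notations of [monalg] clash with those of [constructive_ereal]. *)
From mathcomp Require Import -(notations) monalg.

Set Implicit Arguments.
Unset Strict Implicit.
Unset Printing Implicit Defensive.

Import Order.TTheory GRing.Theory Num.Theory.

Local Open Scope classical_set_scope.
Local Open Scope ring_scope.

(* [V] is the internal direct sum of the subgroups [G i], [i : nat]. *)
Record grading (V : zmodType) (G : nat -> set V) : Prop := Grading {
  gr0 : forall i, G i 0;
  grB : forall i x y, G i x -> G i y -> G i (x - y);
  gr_span : forall x, exists (N : nat) (y : nat -> V),
    (forall i, G i (y i)) /\ x = \sum_(i < N) y i;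
  gr_direct : forall (N : nat) (y : nat -> V), (forall i, G i (y i)) ->
    \sum_(i < N) y i = 0 -> forall i, (i < N)%N -> y i = 0 }.

(* The components are automatically k-subspaces, because A_0 = k. *)
Record connGrAlg (k : fieldType) := ConnGrAlg {
  cga_sort :> algType k;
  cga_comp : nat -> set cga_sort;
  cga_grading : grading cga_comp;
  cga_mul : forall i j x y,
    cga_comp i x -> cga_comp j y -> cga_comp (i + j)%N (x * y);
  cga_connected : cga_comp 0%N = range (fun c : k => c%:A) }.

Record grModule (k : fieldType) (A : connGrAlg k) := GrModule {
  grm_sort :> lmodType A;
  grm_comp : nat -> set grm_sort;
  grm_grading : grading grm_comp;
  grm_scale : forall i j (a : A) x,
    cga_comp i a -> grm_comp j x -> grm_comp (i + j)%N (a *: x) }.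

(* A_+ *)
Definition irrelevant_ideal (k : fieldType) (A : connGrAlg k) : set A :=
  [set a | exists (N : nat) (y : nat -> A),
     (forall i, cga_comp i.+1 (y i)) /\ a = \sum_(i < N) y i].
Arguments irrelevant_ideal {k} A.

Definition augmentation (k : fieldType) (A : connGrAlg k) (a : A) : k :=
  xget 0 [set c : k | irrelevant_ideal A (a - c%:A)].

Section GradingTheory.
Variables (V : zmodType) (G : nat -> set V) (gG : grading G).

Lemma grN i x : G i x -> G i (- x).
Proof. by move=> Gx; rewrite -sub0r; apply: (grB gG) => //; apply: gr0. Qed.

Lemma grD i x y : G i x -> G i y -> G i (x + y).
Proof. by move=> Gx Gy; rewrite -[y]opprK; apply: (grB gG) => //; apply: grN. Qed.

Lemma gr_sum i (I : Type) (s : seq I) (P : pred I) (f : I -> V) :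
  (forall j, P j -> G i (f j)) -> G i (\sum_(j <- s | P j) f j).
Proof.
move=> Gf; elim/big_rec: _ => [|j x Pj Gx]; first exact: gr0.
by apply: grD => //; apply: Gf.
Qed.

End GradingTheory.

Section Decomposable.
Variables (V : zmodType) (G : nat -> set V).
Hypothesis G0 : forall i, G i 0.
Hypothesis GD : forall i x y, G i x -> G i y -> G i (x + y).

Definition hsum (x : V) := exists (N : nat) (y : nat -> V),
    (forall i, G i (y i)) /\ x = \sum_(i < N) y i.

Lemma hsumP x : hsum x <-> exists (N : nat) (y : nat -> V),
  [/\ forall i, G i (y i), forall i, (N <= i)%N -> y i = 0 &
      forall M, (N <= M)%N -> x = \sum_(i < M) y i].
Proof.
split=> [[N [y [Gy ->]]]|[N [y [Gy _ /(_ N (leqnn N)) ->]]]]; last by exists N, y.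
exists N, (fun i => if (i < N)%N then y i else 0); split.
- by move=> i; case: ifP.
- by move=> i; rewrite leqNgt => /negbTE ->.
move=> M NM; rewrite -(big_mkord xpredT (fun j => if (j < N)%N then y j else 0)).
rewrite (big_cat_nat _ NM) //= [X in _ + X]big_nat_cond [X in _ + X]big1.
  by rewrite addr0 big_mkord; apply: eq_bigr => j _; rewrite ltn_ord.
by move=> j; rewrite andbT leqNgt => /andP[/negbTE ->].
Qed.

Lemma hsumD x y : hsum x -> hsum y -> hsum (x + y).
Proof.
move=> /hsumP[N [u [Gu _ su]]] /hsumP[M [v [Gv _ sv]]].
exists (maxn N M), (fun i => u i + v i); split; first by move=> i; apply: GD.
by rewrite big_split /= -su ?leq_maxl// -sv ?leq_maxr.
Qed.

Lemma hsum0 : hsum 0.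
Proof. by exists 0%N, (fun=> 0); rewrite big_ord0. Qed.

Lemma hsum_sum (I : Type) (s : seq I) (P : pred I) (f : I -> V) :
  (forall j, P j -> hsum (f j)) -> hsum (\sum_(j <- s | P j) f j).
Proof.
move=> Gf; elim/big_rec: _ => [|j x Pj Gx]; first exact: hsum0.
by apply: hsumD => //; apply: Gf.
Qed.

Lemma hsum_hom i x : G i x -> hsum x.
Proof.
move=> Gx; exists i.+1, (fun j => if j == i then x else 0); split.
  by move=> j; case: eqP => [->|].
by rewrite -big_mkcond /= (big_pred1 (@ord_max i)) // => j; rewrite -val_eqE.
Qed.

End Decomposable.

Section Augmentation.
Variables (k : fieldType) (A : connGrAlg k).
Local Notation Ap := (irrelevant_ideal A).
Local Notation gA := (cga_grading A).

Let compS0 i : cga_comp i.+1 (0 : A). Proof. exact: gr0 gA _. Qed.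
Let compSD i (x y : A) : cga_comp i.+1 x -> cga_comp i.+1 y -> cga_comp i.+1 (x + y).
Proof. exact: grD gA _ _ _. Qed.

Lemma irr0 : Ap 0. Proof. exact: (@hsum0 _ (fun i => @cga_comp k A i.+1)). Qed.

Lemma irrD x y : Ap x -> Ap y -> Ap (x + y).
Proof. exact: (@hsumD _ (fun i => @cga_comp k A i.+1)). Qed.

Lemma irr_hom i x : cga_comp i.+1 x -> Ap x.
Proof. exact: (@hsum_hom _ (fun i => @cga_comp k A i.+1)). Qed.

Lemma irr_sum (I : Type) (s : seq I) (P : pred I) (f : I -> A) :
  (forall j, P j -> Ap (f j)) -> Ap (\sum_(j <- s | P j) f j).
Proof. exact: (@hsum_sum _ (fun i => @cga_comp k A i.+1)). Qed.

Lemma cga_comp1 : cga_comp 0%N (1 : A).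
Proof. by rewrite cga_connected; exists 1; rewrite // scale1r. Qed.

Lemma irrMl x y : Ap y -> Ap (x * y).
Proof.
move=> [N [v [Gv ->]]]; rewrite mulr_sumr; apply: irr_sum => j _.
have [M [u [Gu ->]]] := gr_span gA x.
rewrite mulr_suml; apply: irr_sum => i _.
by apply: (@irr_hom (i + j)); rewrite -addnS; apply: cga_mul.
Qed.

Lemma irrMr x y : Ap x -> Ap (x * y).
Proof.
move=> [N [v [Gv ->]]]; rewrite mulr_suml; apply: irr_sum => j _.
have [M [u [Gu ->]]] := gr_span gA y.
rewrite mulr_sumr; apply: irr_sum => i _.
by apply: (@irr_hom (j + i)); rewrite -addSn; apply: cga_mul.
Qed.

Lemma irrN x : Ap x -> Ap (- x).
Proof. by rewrite -mulN1r; apply: irrMl. Qed.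

Lemma irr_scal (c : k) : Ap c%:A -> c = 0.
Proof.
move=> [N [v [Gv E]]]; apply: contrapT => /eqP c0.
pose y i := if i is j.+1 then v j else - c%:A.
have Gy i : cga_comp i (y i).
  case: i => [|i]; last exact: Gv.
  by rewrite /= cga_connected; exists (- c); rewrite // scaleNr.
have := gr_direct gA (N := N.+1) Gy; rewrite big_ord_recl /= -E addNr.
by move/(_ erefl 0%N isT)/eqP; rewrite oppr_eq0 scaler_eq0 (negPf c0) oner_eq0.
Qed.

Lemma aug_exists (a : A) : exists c : k, Ap (a - c%:A).
Proof.
have [N [y [Gy ->]]] := gr_span gA a.
case: N => [|N]; first by exists 0; rewrite scale0r big_ord0 subr0; apply: irr0.
have := Gy 0%N; rewrite cga_connected => -[c _ Ec]; exists c.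
rewrite big_ord_recl /= Ec addrAC subrr add0r.
by apply: irr_sum => i _; apply: irr_hom (Gy _).
Qed.

Lemma augP (a : A) : Ap (a - (augmentation a)%:A).
Proof.
have [c Hc] := aug_exists a.
by rewrite /augmentation; case: xgetP => [x _ //|/(_ c)].
Qed.

Lemma augE (a : A) c : Ap (a - c%:A) -> augmentation a = c.
Proof.
move=> H; apply/eqP; rewrite -subr_eq0; apply/eqP/irr_scal.
rewrite scalerBl.
have -> : (augmentation a)%:A - c%:A = (a - c%:A) - (a - (augmentation a)%:A).
  by rewrite opprB [RHS]addrC addrA addrNK.
by apply: irrD => //; apply/irrN/augP.
Qed.

Lemma aug1 : augmentation (1 : A) = 1.
Proof. by apply: augE; rewrite scale1r subrr; apply: irr0. Qed.

Lemma augD : {morph @augmentation k A : x y / x + y}.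
Proof.
move=> x y; apply: augE; rewrite scalerDl opprD addrACA.
by apply: irrD; apply: augP.
Qed.

Lemma augM : {morph @augmentation k A : x y / x * y}.
Proof.
move=> x y; apply: augE.
have -> : x * y - (augmentation x * augmentation y)%:A =
  (x - (augmentation x)%:A) * y +
  (augmentation x)%:A * (y - (augmentation y)%:A).
  by rewrite mulrBl mulrBr addrA addrNK -scalerAl mul1r scalerA.
by apply: irrD; [apply: irrMr | apply: irrMl]; apply: augP.
Qed.

Lemma aug_irr a : Ap a -> augmentation a = 0.
Proof. by move=> ?; apply: augE; rewrite scale0r subr0. Qed.

End Augmentation.

Definition trivial_module (k : fieldType) (A : connGrAlg k) : Type := k.

Section TrivialModule.
Variables (k : fieldType) (A : connGrAlg k).

HB.instance Definition _ := GRing.Zmodule.on (trivial_module A).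

Definition trivial_scale (a : A) (x : trivial_module A) : trivial_module A :=
  augmentation a * (x : k).

Fact trivial_scaleA a b x :
  trivial_scale a (trivial_scale b x) = trivial_scale (a * b) x.
Proof. by rewrite /trivial_scale augM mulrA. Qed.

Fact trivial_scale1 : left_id 1 trivial_scale.
Proof. by move=> x; rewrite /trivial_scale aug1 mul1r. Qed.

Fact trivial_scaleDr : right_distributive trivial_scale +%R.
Proof. by move=> a x y; rewrite /trivial_scale mulrDr. Qed.

Fact trivial_scaleDl x : {morph trivial_scale^~ x : a b / a + b}.
Proof. by move=> a b; rewrite /trivial_scale augD mulrDl. Qed.

HB.instance Definition _ := GRing.Zmodule_isLmodule.Build A (trivial_module A)
  trivial_scaleA trivial_scale1 trivial_scaleDr trivial_scaleDl.

Definition trivial_comp (i : nat) : set (trivial_module A) :=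
  if i is 0%N then setT else [set 0].

Fact trivial_grading : grading trivial_comp.
Proof.
split=> [[|i]|[|i] x y|x|N y Gy] //=.
- by move=> -> ->; rewrite subr0.
- exists 1%N, (fun i => if i is 0%N then x else 0); split; first by case.
  by rewrite big_ord1.
case: N => // N; have y0 i : y i.+1 = 0 by apply: (Gy i.+1).
rewrite big_ord_recl big1 => [|i _]; last exact: y0.
by rewrite addr0 => y00 [|i] _.
Qed.

Fact trivial_comp_scale i j (a : A) (x : trivial_module A) :
  cga_comp i a -> trivial_comp j x -> trivial_comp (i + j) (a *: x).
Proof.
case: i j => [|i] [|j] //= Ha; last by move=> ->; rewrite scaler0.
  by move=> ->; rewrite scaler0.
move=> _; rewrite /GRing.scale /= /trivial_scale aug_irr ?mul0r //.
exact: irr_hom Ha.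
Qed.

Definition trivial_grModule : grModule A :=
  GrModule trivial_grading trivial_comp_scale.

End TrivialModule.

Section Resolutions.
Variables (k : fieldType) (A : connGrAlg k).

Definition degree_preserving (M N : grModule A) (f : M -> N) : Prop :=
  forall i x, grm_comp i x -> grm_comp i (f x).

Definition is_basis (M : grModule A) (I : choiceType) (e : I -> M) : Prop :=
  (forall x, exists (s : seq I) (c : I -> A), x = \sum_(i <- s) c i *: e i) /\
  (forall (s : seq I) (c : I -> A), uniq s ->
     \sum_(i <- s) c i *: e i = 0 -> forall i, i \in s -> c i = 0).

Definition graded_free (M : grModule A) : Prop :=
  exists (I : choiceType) (deg : I -> nat) (e : I -> M),
    (forall i, grm_comp (deg i) (e i)) /\ is_basis e.

(* ... -> res_mod 1 -> res_mod 0 -> M -> 0 *)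
Record free_resolution (M : grModule A) := FreeResolution {
  res_mod : nat -> grModule A;
  res_aug : {linear res_mod 0%N -> M};
  res_diff : forall i, {linear res_mod i.+1 -> res_mod i};
  res_free : forall i, graded_free (res_mod i);
  res_aug_deg : degree_preserving res_aug;
  res_diff_deg : forall i, degree_preserving (res_diff i);
  res_aug_surj : range res_aug = setT;
  res_exact0 : range (res_diff 0%N) = [set x | res_aug x = 0];
  res_exactS : forall i, range (res_diff i.+1) = [set x | res_diff i x = 0] }.

End Resolutions.

Section StandardResolution.
Variables (k : fieldType) (A : connGrAlg k).
Local Notation gA := (cga_grading A).

Definition graded_sub (M : grModule A) (K : set M) : Prop :=
  forall x, K x -> exists (N : nat) (y : nat -> M),
    (forall i, grm_comp i (y i) /\ K (y i)) /\ x = \sum_(i < N) y i.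

Lemma graded_sub_ker (M N : grModule A) (f : {linear M -> N}) :
  degree_preserving f -> graded_sub [set x | f x = 0].
Proof.
move=> df x /= fx0.
have [n [y [Gy _ /(_ n (leqnn n)) Ex]]] :=
  (hsumP (gr0 (grm_grading M)) x).1 (gr_span (grm_grading M) x).
exists n, (fun i => if (i < n)%N then y i else 0); split; last first.
  by rewrite Ex; apply: eq_bigr => i _; rewrite ltn_ord.
move=> i; case: ifPn => ni; last by split; [apply: gr0 (grm_grading M) _|rewrite /= linear0].
split => //=; apply: (gr_direct (grm_grading N) (N := n) (y := f \o y)) => //.
  by move=> j; apply: df.
by rewrite /= -linear_sum -Ex.
Qed.

Section Cover.
Variables (M : grModule A) (K : set M).

Definition cover_index : choiceType :=
  {x : (M : Type) * nat | `[< grm_comp x.2 x.1 /\ K x.1 >]}.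

Definition cover_deg (x : cover_index) : nat := (val x).2.

Definition cover_sort : lmodType A := malg cover_index A.

Definition cover_comp (n : nat) : set cover_sort :=
  [set f | forall x : cover_index,
     if (cover_deg x <= n)%N then cga_comp (n - cover_deg x)%N (mcoeff x f)
     else mcoeff x f = 0].

Lemma cover_compU n (x : cover_index) a :
  cga_comp n a -> cover_comp (n + cover_deg x) (mkmalgU x a).
Proof.
move=> Ga y; rewrite mcoeffU; case: eqP => [<-|_].
  by rewrite leq_addl addnK.
by case: ifP => // _; apply: gr0 gA _.
Qed.

Fact cover_grading : grading cover_comp.
Proof.
have C0 i : cover_comp i 0.
  by move=> x; rewrite mcoeff0; case: ifP => // _; apply: gr0 gA _.
have CB i f g : cover_comp i f -> cover_comp i g -> cover_comp i (f - g).
  move=> Cf Cg x; have := Cf x; have := Cg x; rewrite mcoeffB.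
  by case: ifP => _; [move=> ? ?; apply: grB gA _ _ _ _ _| move=> -> ->; rewrite subr0].
have CD i f g : cover_comp i f -> cover_comp i g -> cover_comp i (f + g).
  by move=> Cf Cg; rewrite -[g]opprK -[- g]sub0r; do 2![apply: (CB) => //].
split => // [f|N f Cf sf i iN].
  rewrite [f]monalgE; apply: (hsum_sum C0 CD) => x _.
  have [N [y [Gy ->]]] := gr_span gA (mcoeff x f).
  rewrite raddf_sum; apply: (hsum_sum C0 CD) => i _.
  by apply: (hsum_hom C0); apply: cover_compU.
apply/malgP => x; rewrite mcoeff0; have := Cf i x; case: leqP => // di _.
pose d := cover_deg x.
pose y j := if (j + d < N)%N then mcoeff x (f (j + d)%N) else 0.
have Gy j : cga_comp j (y j).
  rewrite /y; case: ifP => _; last exact: gr0 gA _.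
  by have := Cf (j + d)%N x; rewrite leq_addl addnK.
have dN : (d <= N)%N by apply: leq_trans di (ltnW iN).
suff sy : \sum_(j < (N - d)%N) y j = 0.
  have := gr_direct gA Gy sy (i := (i - d)%N).
  by rewrite ltn_sub2r ?(leq_ltn_trans di) // /y subnK // iN => /(_ isT).
have := congr1 (mcoeff x) sf; rewrite raddf_sum mcoeff0 => E.
rewrite -[RHS]E -[RHS](big_mkord xpredT (fun j => mcoeff x (f j))).
rewrite (big_cat_nat (leq0n d) dN) //= [X in _ = X + _]big_nat_cond.
rewrite [X in _ = X + _]big1 ?add0r => [|j]; last first.
  by rewrite andbT /= => jd; have := Cf j x; rewrite leqNgt jd.
rewrite -[d in RHS]add0n big_addn big_mkord; apply: eq_bigr => j _.
by rewrite /y addnC -ltn_subRL ltn_ord.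
Qed.

Fact cover_scale i j (a : A) (f : cover_sort) :
  cga_comp i a -> cover_comp j f -> cover_comp (i + j) (a *: f).
Proof.
move=> Ga Cf x; have := Cf x; rewrite mcoeffZ.
case: leqP => [dj Gf|dj ->]; rewrite ?mulr0.
  by rewrite (leq_trans dj (leq_addl _ _)) -addnBA //; apply: cga_mul.
by case: ifP => // _; apply: gr0 gA _.
Qed.

Definition cover : grModule A := GrModule cover_grading cover_scale.

Definition cover_fun (f : cover) : M :=
  \sum_(x <- msupp f) mcoeff x f *: (val x).1.

Lemma cover_funEw (f : cover) (D : {fset cover_index}) : (msupp f `<=` D)%fset ->
  cover_fun f = \sum_(x <- D) mcoeff x f *: (val x).1.
Proof.
move=> sD; rewrite /cover_fun; apply: big_fset_incl => // x _.
by rewrite -mcoeff_eq0 => /eqP ->; rewrite scale0r.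
Qed.

Fact cover_fun_linear : linear cover_fun.
Proof.
move=> a f g; pose D := (msupp (a *: f + g) `|` (msupp f `|` msupp g))%fset.
rewrite (@cover_funEw _ D) ?fsubsetUl //.
rewrite (@cover_funEw f D); last by rewrite /D fsetUCA fsubsetUl.
rewrite (@cover_funEw g D); last by rewrite /D fsetUA fsubsetUr.
rewrite scaler_sumr -big_split /=; apply: eq_bigr => x _.
by rewrite mcoeffD mcoeffZ scalerDl scalerA.
Qed.

HB.instance Definition _ :=
  GRing.isLinear.Build A cover M *:%R cover_fun cover_fun_linear.

Definition cover_map : {linear cover -> M} := cover_fun.

Fact cover_mapU x (a : A) : cover_map (mkmalgU x a) = a *: (val x).1.
Proof.
rewrite /= (cover_funEw (msuppU_le (k := x) (x := a))).
by rewrite big_seq_fset1 mcoeffUU.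
Qed.

Fact cover_map_deg : degree_preserving cover_map.
Proof.
move=> i f Cf; apply: (gr_sum (grm_grading M)) => x _.
have := Cf x; case: ifP => [di Ga|_ ->]; last first.
  by rewrite scale0r; apply: gr0 (grm_grading M) _.
rewrite -[i in grm_comp i _](subnK di); apply: grm_scale => //.
by have /asboolP[] := valP x.
Qed.

Fact cover_free : graded_free cover.
Proof.
exists cover_index, cover_deg, (fun x => mkmalgU x 1 : cover); split.
  by move=> x; rewrite /= -[cover_deg x]add0n; apply: cover_compU; apply: cga_comp1.
have ZU a (x : cover_index) : a *: (mkmalgU x 1 : cover) = mkmalgU x a.
  by apply/malgP => y; rewrite mcoeffZ !mcoeffU mulrnAr mulr1.
split=> [f|s c us sc x xs].
  exists (msupp f), (mcoeff^~ f); rewrite {1}[f]monalgE.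
  by apply: eq_bigr => x _; rewrite ZU.
have := congr1 (mcoeff x) sc; rewrite raddf_sum mcoeff0.
rewrite (bigD1_seq x) //= ZU mcoeffUU big1 ?addr0 // => y yx.
by rewrite ZU mcoeffU (negPf yx).
Qed.

Fact cover_range : K 0 -> (forall a x y, K x -> K y -> K (a *: x + y)) ->
  graded_sub K -> range cover_map = K.
Proof.
move=> K0 KL KG; apply/seteqP; split=> [_ [f _ <-]|x /KG[N [y [Gy ->]]]].
  rewrite /cover_map /= /cover_fun; elim/big_rec: _ => // x y _; apply: KL.
  by have /asboolP[] := valP x.
have H i : exists f, cover_map f = y i.
  have Hi : `[< grm_comp (y i, i).2 (y i, i).1 /\ K (y i, i).1 >] by apply/asboolP.
  by exists (mkmalgU (exist _ (y i, i) Hi : cover_index) 1); rewrite cover_mapU scale1r.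
have [f Hf] := choice H.
by exists (\sum_(i < N) f i) => //; rewrite linear_sum; apply: eq_bigr => i _; apply: Hf.
Qed.

End Cover.

Record stage := Stage {
  stage_tgt : grModule A;
  stage_src : grModule A;
  stage_map : {linear stage_src -> stage_tgt} }.

Definition stage_start (M : grModule A) : stage := Stage (cover_map (@setT M)).

Definition stage_next (s : stage) : stage :=
  Stage (cover_map [set x | stage_map s x = 0]).

Section Standard.
Variable M : grModule A.

Definition std_stage (i : nat) : stage := iter i stage_next (stage_start M).

Definition std_mod (i : nat) : grModule A := stage_src (std_stage i).

Definition std_diff (i : nat) : {linear std_mod i.+1 -> std_mod i} :=
  stage_map (std_stage i.+1).

Definition std_aug : {linear std_mod 0%N -> M} := stage_map (std_stage 0%N).

Fact std_deg i : degree_preserving (stage_map (std_stage i)).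
Proof. by case: i => [|i]; apply: cover_map_deg. Qed.

Fact std_free i : graded_free (std_mod i).
Proof. by case: i => [|i]; apply: cover_free. Qed.

Fact std_exact i :
  range (std_diff i) = [set x | stage_map (std_stage i) x = 0].
Proof.
apply: cover_range => /=.
- exact: linear0.
- by move=> a x y /= x0 y0; rewrite linearP x0 y0 scaler0 addr0.
- by apply: graded_sub_ker; apply: std_deg.
Qed.

Fact std_surj : range std_aug = setT.
Proof.
apply: cover_range => // x _.
have [N [y [Gy ->]]] := gr_span (grm_grading M) x.
by exists N, y; split.
Qed.

(* P_0 is free on the homogeneous elements of M, and P_(i+1) is free on the
   homogeneous elements of the kernel of the previous map. *)
Definition standard_resolution : free_resolution M :=
  @FreeResolution k A M std_mod std_aug std_diff std_free
    (@std_deg 0%N) (fun i => @std_deg i.+1) std_surj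
    (std_exact 0%N) (fun i => std_exact i.+1).

End Standard.

End StandardResolution.

Section Tor.
Variables (k : fieldType) (A : connGrAlg k).

(* A_+ M, so that k (x)_A M = M / A_+ M *)
Definition irrelevant_mul (M : grModule A) : set M :=
  [set x | exists (N : nat) (a : nat -> A) (y : nat -> M),
     (forall l, irrelevant_ideal A (a l)) /\ x = \sum_(l < N) a l *: y l].

(* Cycles and boundaries of degree [j] of the complex k (x)_A P, as homogeneous
   elements of [P_i]; both contain (A_+ P_i)_j, and the boundaries are
   cycles, so that H_i(k (x)_A P)_j is their quotient. *)
Definition tor_cycles (M : grModule A) (P : free_resolution M) (i j : nat) :
    set (res_mod P i) :=
  match i return set (res_mod P i) with
  | 0%N => [set x | grm_comp j x]
  | i'.+1 => [set x | grm_comp j x /\ irrelevant_mul (res_diff P i' x)]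
  end.

Definition tor_boundaries (M : grModule A) (P : free_resolution M) (i j : nat) :
    set (res_mod P i) :=
  [set x | grm_comp j x /\
     exists2 y : res_mod P i.+1, grm_comp j y & irrelevant_mul (x - res_diff P i y)].

Arguments tor_cycles {M} P i j.
Arguments tor_boundaries {M} P i j.

(* Tor_i^A(k, k)_j <> 0; up to isomorphism the homology does not depend on the
   graded free resolution, so the standard one is taken for definiteness. *)
Definition tor_neq0 (i j : nat) : Prop :=
  let P := standard_resolution (trivial_grModule A) in
  ~ (tor_cycles P i j `<=` tor_boundaries P i j).

(* m_i(A); the default value of [supremum] on the empty set is 0. *)
Definition m_ (i : nat) : \bar int :=
  supremum 0%E [set (j%:Z)%:E | j in [set j | tor_neq0 i j]].

End Tor.
Arguments tor_neq0 {k} A i j.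
Arguments m_ {k} A i.

Definition has_dim (k : fieldType) (V : lmodType k) (U : set V) (d : nat) : Prop :=
  exists e : 'I_d -> V,
    (forall c : 'I_d -> k, \sum_i c i *: e i = 0 -> forall i, c i = 0) /\
    U = [set \sum_i c i *: e i | c in [set: 'I_d -> k]].

(* The power series sum_i (dim A_i) z^i, as its sequence of coefficients; the
   value at [i] is 0 by default when A_i is infinite-dimensional. *)
Definition hilbert_series (k : fieldType) (A : connGrAlg k) : nat -> nat :=
  fun i => xget 0%N (has_dim (@cga_comp k A i)).

Definition generated_by (k : fieldType) (A : connGrAlg k) (s : seq A) : Prop :=
  forall S : {pred A}, GRing.subalg_closed S -> {subset s <= S} -> S =i predT.

Definition at_most_generators (k : fieldType) (A : connGrAlg k) (n : nat) : Prop :=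
  exists s : seq A, [/\ (size s <= n)%N,
    forall x, x \in s -> exists i, cga_comp i x & generated_by s].

(* D(n, a, b, c), as a predicate: connGrAlg k is too large for [set]. *)
Definition D (k : fieldType) (n a b c : nat) (A : connGrAlg k) : Prop :=
  [/\ at_most_generators A n,
      (m_ A 1%N <= (a%:Z)%:E)%E, (m_ A 2%N <= (b%:Z)%:E)%E & (m_ A 3%N <= (c%:Z)%:E)%E].

(* Main.v *)
(** A generating set of [A] with degrees at most [a] presents [A] as [F / I], with [F]
    free on generators x_1, ..., x_n.  By Govorov's formulas, Tor_2 = I / (F_+ I + I F_+)
    and Tor_3 = (F_+ I /\ I F_+) / (I I + F_+ I F_+), so that in degrees j > max(a, b, c)
      dim I_j = dim (F_+ I)_j + dim (I F_+)_j - dim (I I + F_+ I F_+)_j,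
    where the right-hand side only involves I in degrees below j, and the first two terms
    only its dimensions there.
    The algebra is determined by the components of I of degree at most max(a, b, c), a
    point of an affine space over k, and each dim I_j and dim (I I + F_+ I F_+)_j is the
    rank of a matrix of polynomials in that point, hence lower semicontinuous.  If there
    were infinitely many Hilbert series for given degrees of the generators, then, affine
    space being Noetherian, infinitely many of the corresponding points would form a set S
    on which every polynomial vanishes either identically or at finitely many points only;
    so each of these ranks takes its maximal value at all but finitely many points of S.
    Dropping finitely many points, dim I_j is maximal on S for all j <= max(a, b, c).  For
    larger j, by induction, the displayed formula shows that dim I_j is at least its generic
    value, which is its maximum, so that all points left have the same Hilbert series. *)

From HB Require Import structures.
From mathcomp Require Import all_boot all_order all_algebra.
From mathcomp Require Import finmap.
From mathcomp Require Import boolp classical_sets cardinality constructive_ereal.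
From mathcomp Require Import zify.
From mathcomp Require Import -(notations) monalg.
Require Import Defs.

Set Implicit Arguments.
Unset Strict Implicit.
Unset Printing Implicit Defensive.

Import Order.TTheory GRing.Theory Num.Theory.

Local Open Scope classical_set_scope.
Local Open Scope ring_scope.

(** * Noetherian rings and semicontinuity of the rank *)

Section Noetherian.

Definition comb (R : comNzRingType) (f : nat -> R) (n : nat) : set R :=
  [set x | exists c : nat -> R, x = \sum_(i < n) c i * f i].

(** The ascending chain condition in terms of sequences: some term lies in the ideal [comb f n]
    generated by the terms before it. *)
Definition noetherian (R : comNzRingType) :=
  forall f : nat -> R, exists n, comb f n (f n).

Section Comb.
Variables (R : comNzRingType) (f : nat -> R).

Lemma comb0 n : comb f n 0.
Proof. by exists (fun=> 0); rewrite big1 // => i _; rewrite mul0r. Qed.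

Lemma combD n x y : comb f n x -> comb f n y -> comb f n (x + y).
Proof.
move=> [c ->] [d ->]; exists (fun i => c i + d i).
by rewrite -big_split; apply: eq_bigr => i _; rewrite mulrDl.
Qed.

Lemma combM n a x : comb f n x -> comb f n (a * x).
Proof.
move=> [c ->]; exists (fun i => a * c i).
by rewrite mulr_sumr; apply: eq_bigr => i _; rewrite mulrA.
Qed.

Lemma comb_sum n (I : Type) (s : seq I) (P : pred I) (g : I -> R) :
  (forall i, P i -> comb f n (g i)) -> comb f n (\sum_(i <- s | P i) g i).
Proof.
move=> H; elim/big_rec: _ => [|i x Pi Hx]; first exact: comb0.
by apply: combD => //; apply: H.
Qed.

Lemma comb_gen n i : (i < n)%N -> comb f n (f i).
Proof.
move=> iltn; exists (fun j => (j == i)%:R).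
rewrite (bigD1 (Ordinal iltn)) //= eqxx mul1r big1 ?addr0 // => j ji.
by rewrite -val_eqE in ji; rewrite (negPf ji) mul0r.
Qed.

Lemma comb_le m n x : (m <= n)%N -> comb f m x -> comb f n x.
Proof.
move=> mn [c ->]; apply: comb_sum => i _; apply: combM; apply: comb_gen.
exact: leq_trans mn.
Qed.

End Comb.

Lemma noetherian_field (k : fieldType) : noetherian k.
Proof.
move=> f; have [f0|/eqP f0] := eqVneq (f 0%N) 0; first by exists 0%N; rewrite f0; exact: comb0.
exists 1%N, (fun=> f 1%N / f 0%N).
by rewrite big_ord1 divfK //; apply/eqP.
Qed.

(** * Hilbert's basis theorem *)

Section HilbertBasis.
Variables (R : comNzRingType) (noethR : noetherian R).

Lemma degree_arith a b : (0 < b)%N -> (b <= a)%N ->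
  ((a.-1 < a - b)%N = false) * ((a.-1 - (a - b))%N = b.-1).
Proof. by move=> b0 ba; split; lia. Qed.

(** Every summand is shifted to the degree of [p], so that the relation between leading coefficients
    cancels the top coefficient. A zero [q i] contributes nothing. *)
Lemma lead_coef_cancel (p : {poly R}) (n : nat) (q : nat -> {poly R}) (c : nat -> R) :
  p != 0 -> (forall i, (i < n)%N -> (size (q i) <= size p)%N) ->
  lead_coef p = \sum_(i < n) c i * lead_coef (q i) ->
  (size (p - \sum_(i < n) ((c i)%:P * 'X^(size p - size (q i))%N) * q i)%R < size p)%N.
Proof.
move=> p0 sq lp; have sp : (0 < size p)%N by rewrite size_poly_gt0.
rewrite -[X in (_ < X)%N](prednK sp) ltnS; apply/leq_sizeP => j jp.
rewrite coefB coef_sum; have [->|jn] := eqVneq j (size p).-1.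
  rewrite -lead_coefE lp -sumrB big1 // => i _.
  rewrite -mulrA coefCM coefXnM; have si := sq _ (ltn_ord i).
  have [qi0|qi0] := eqVneq (q i) 0.
    by rewrite qi0 lead_coef0 coef0 if_same subrr.
  have qs : (0 < size (q i))%N by rewrite size_poly_gt0.
  have [-> ->] := degree_arith qs si.
  by rewrite -lead_coefE subrr.
have jp' : (size p <= j)%N by rewrite -(prednK sp) ltn_neqAle eq_sym jn.
rewrite nth_default // sub0r big1 ?oppr0 // => i _.
rewrite -mulrA coefCM coefXnM; have si := sq _ (ltn_ord i).
case: ifP => _; first by rewrite mulr0.
by rewrite [X in _ * X]nth_default ?mulr0 // leq_subRL ?(leq_trans (leq_subr _ _)) // subnK.
Qed.

(** Hilbert's argument: in an ideal that is not finitely generated, choose successively elements of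
    least size outside the span of the earlier ones. Once a leading coefficient depends on the
    earlier ones, cancelling it gives a smaller element outside the span. *)
Lemma noetherian_poly : noetherian {poly R}.
Proof.
move=> f; apply: contrapT => bad.
pose J : set {poly R} := [set x | exists n, comb f n x].
pose span (s : seq {poly R}) := comb (nth 0 s) (size s).
have JD x y : J x -> J y -> J (x + y).
  move=> [m Hx] [n Hy]; exists (maxn m n).
  by apply: combD; [apply: comb_le Hx|apply: comb_le Hy]; rewrite ?leq_maxl ?leq_maxr.
have JM a x : J x -> J (a * x) by move=> [m Hx]; exists m; apply: combM.
(* No finite list spans [J]: its members lie in the ideal of the first m terms of [f] for some m,
   and the next term does not. *)
have next0 s : {in s, forall x, J x} -> exists g, J g /\ ~ span s g.
  move=> sJ; have [m Hm] : exists m, {in s, forall x, comb f m x}.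
    elim: s sJ => [|x s IH] sJ; first by exists 0%N.
    have [|m Hm] := IH; first by move=> y ys; apply: sJ; rewrite inE ys orbT.
    have [n Hn] := sJ x (mem_head _ _); exists (maxn m n) => y.
    rewrite inE => /orP[/eqP->|ys]; first by apply: comb_le Hn; rewrite leq_maxr.
    by apply: comb_le (Hm _ ys); rewrite leq_maxl.
  exists (f m); split; first by exists m.+1; apply: comb_gen.
  move=> [c E]; apply: bad; exists m; rewrite E; apply: comb_sum => i _.
  by apply: combM; apply: Hm; apply: mem_nth.
have [next nextP] : exists next, forall s, {in s, forall x, J x} ->
    [/\ J (next s), ~ span s (next s) &
      forall g, J g -> ~ span s g -> (size (next s) <= size g)%N].
  suff /choice[next nextP] : forall s, exists g, {in s, forall x, J x} ->
      [/\ J g, ~ span s g & forall h, J h -> ~ span s h -> (size g <= size h)%N].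
    by exists next.
  move=> s; have [sJ|nsJ] := pselect {in s, forall x, J x}; last by exists 0.
  have ex : exists n, `[< exists g, [/\ J g, ~ span s g & size g = n] >].
    by have [g [Jg sg]] := next0 _ sJ; exists (size g); apply/asboolP; exists g.
  case: (ex_minnP ex) => n /asboolP[g [Jg sg gn]] min; exists g => _; split=> // h Jh sh.
  by rewrite gn; apply: min; apply/asboolP; exists h.
(* [l n] lists the first [n] choices and [g n] is the next one. *)
pose l := fix l n := if n is m.+1 then rcons (l m) (next (l m)) else [::].
pose g n := next (l n).
have sl n : size (l n) = n by elim: n => //= n IH; rewrite size_rcons IH.
have lJ n : {in l n, forall x, J x}.
  elim: n => //= n IH x; rewrite mem_rcons inE => /orP[/eqP->|]; last exact: IH.
  by have [] := nextP _ IH.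
have nthl n i : (i < n)%N -> nth 0 (l n) i = g i.
  elim: n => // n IH; rewrite ltnS leq_eqVlt /= nth_rcons sl => /orP[/eqP->|ilt].
    by rewrite ltnn eqxx.
  by rewrite ilt IH.
have spanE n x : span (l n) x <-> comb g n x.
  rewrite /span sl; split=> -[c ->]; exists c; apply: eq_bigr => i _; rewrite nthl //.
have [n [c lc]] := noethR (fun i => lead_coef (g i)).
have [Jn sn _] := nextP _ (lJ n).
(* [g n] was already a candidate when [g i] was chosen, because it avoids the smaller span too. *)
have smin i : (i < n)%N -> (size (g i) <= size (g n))%N.
  move=> iltn; have [_ _] := nextP _ (lJ i); apply=> //.
  by move=> /spanE H; apply/sn/spanE; apply: comb_le H; apply: ltnW.
have gn0 : g n != 0.
  by apply/eqP => g0; apply: sn; rewrite -/(g n) g0; apply/spanE; apply: comb0.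
have Jc : J (\sum_(i < n) ((c i)%:P * 'X^(size (g n) - size (g i))%N) * g i).
  elim/big_rec: _ => [|i x _]; first by exists 0%N; apply: comb0.
  by apply: JD; apply: JM; have [] := nextP _ (lJ i).
have := lead_coef_cancel gn0 smin lc; rewrite ltnNge => /negP; apply.
have [_ _] := nextP _ (lJ n); apply.
  by apply: JD => //; rewrite -mulN1r; apply: JM.
move=> /spanE H; apply/sn/spanE.
rewrite -/(g n) -[g n](subrK (\sum_(i < n) ((c i)%:P * 'X^(size (g n) - size (g i))%N) * g i)).
by apply: combD H _; exists (fun i => (c i)%:P * 'X^(size (g n) - size (g i))%N).
Qed.

End HilbertBasis.

(** [P] is an iterated polynomial ring over [k]. What is kept of it is that it is Noetherian and
    that its variables can be evaluated at any point. *)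
Lemma polynomial_functions (k : fieldType) (I : finType) :
  exists (P : comNzRingType) (X : I -> P), noetherian P /\
    forall q : I -> k, exists ev : {rmorphism P -> k}, forall i, ev (X i) = q i.
Proof.
suff [P [X [noethP ev]]] : exists (P : comNzRingType) (X : nat -> P), noetherian P /\
    forall q : nat -> k, exists ev : {rmorphism P -> k}, forall i, (i < #|I|)%N -> ev (X i) = q i.
  exists P, (fun i => X (enum_rank i)); split=> // q.
  have [e He] := ev (fun j => if (insub j : option 'I_#|I|) is Some i then q (enum_val i) else 0).
  by exists e => i; rewrite He // valK enum_rankK.
elim: #|I| => [|m [P [X [noethP ev]]]].
  by exists k, (fun=> 0); split; [apply: noetherian_field|move=> q; exists idfun].
exists {poly P}, (fun i => if i == m then 'X else (X i)%:P); split.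
  exact: noetherian_poly.
move=> q; have [e He] := ev q.
have cq : commr_rmorph e (q m) by move=> x; apply: mulrC.
exists (horner_morph cq) => i; cbn beta; rewrite ltnS leq_eqVlt.
case: eqP => [-> _|_ im]; first exact: horner_morphX.
by apply: etrans (horner_morphC cq _) _; rewrite He.
Qed.

End Noetherian.

(** * Irreducible sets of points and generic ranks *)

Section Irreducible.
Variables (k : fieldType) (P : comNzRingType) (noethP : noetherian P).
Variables (T : Type) (ev : T -> {rmorphism P -> k}).

(** For infinite [S] this strengthens irreducibility of the closure: if a product vanishes on [S],
    one factor vanishes at infinitely many points, hence on all of [S]. *)
Definition irreducible_pts (S : set T) :=
  forall f : P, (forall q, S q -> ev q f = 0) \/ finite_set [set q | S q /\ ev q f = 0].

(** Otherwise every infinite subset of [Z] contains an infinite zero set of a polynomial that is not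
    identically zero on it. Iterating gives polynomials none of which is in the ideal of its
    predecessors: these all vanish on the current set, the new one does not. *)
Lemma exists_irreducible (Z : set T) : infinite_set Z ->
  exists S, [/\ S `<=` Z, infinite_set S & irreducible_pts S].
Proof.
move=> Zinf; apply: contrapT => no.
pose ok Y := Y `<=` Z /\ infinite_set Y.
have /choice[step stepP] : forall Y, exists r : set T * P, ok Y ->
    [/\ r.1 `<=` Y, infinite_set r.1, (forall q, r.1 q -> ev q r.2 = 0) &
        ~ forall q, Y q -> ev q r.2 = 0].
  move=> Y; have [[YZ Yinf]|] := pselect (ok Y); last by exists (set0, 0).
  have [f Hf] : exists f : P, ~ ((forall q, Y q -> ev q f = 0) \/
      finite_set [set q | Y q /\ ev q f = 0]).
    by apply/not_existsP => H; apply: no; exists Y; split=> // f; apply: contrapT (H f).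
  exists ([set q | Y q /\ ev q f = 0], f) => _; split=> /=.
  - by move=> q [].
  - by move=> fin; apply: Hf; right.
  - by move=> q [].
  - by move=> z; apply: Hf; left.
pose Y n := iter n (fun Y => (step Y).1) Z.
have Yok n : ok (Y n).
  elim: n => [|n [YZ Yinf]]; first by split.
  have [sY inf _ _] := stepP _ (conj YZ Yinf).
  by split=> //; apply: subset_trans YZ.
have Yle m n : (m <= n)%N -> Y n `<=` Y m.
  move=> /subnK <-; elim: (n - m)%N => // d IH; apply: subset_trans IH.
  by rewrite addSn /=; have [] := stepP _ (Yok (d + m)%N).
have [n [c E]] := noethP (fun n => (step (Y n)).2).
have [_ _ _] := stepP _ (Yok n); apply=> q Yq; rewrite E rmorph_sum big1 // => i _.
rewrite rmorphM; have [_ _ z _] := stepP _ (Yok i).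
by rewrite z ?mulr0 //; apply: (Yle i.+1).
Qed.

Lemma mxrank_mxsub (F : fieldType) m n m' n' (f : 'I_m' -> 'I_m) (g : 'I_n' -> 'I_n)
    (A : 'M[F]_(m, n)) : (\rank (mxsub f g A) <= \rank A)%N.
Proof.
rewrite -[A]mulmx1 mxsub_mul (leq_trans (mxrankM_maxl _ _)) // mulmx1.
exact/mxrankS/rowsub_sub.
Qed.

(** Choose a maximal set of independent rows, then independent columns of the matrix they form. *)
Lemma mxrank_minor (F : fieldType) m n (A : 'M[F]_(m, n)) :
  exists (f : 'I_(\rank A) -> 'I_m) (g : 'I_(\rank A) -> 'I_n), \det (mxsub f g A) != 0.
Proof.
have rfree : row_free (rowsub (maxrankfun A) A) by exact: maxrowsub_free.
set B := rowsub _ A in rfree.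
have full : row_full B^T by rewrite /row_full mxrank_tr.
exists (maxrankfun A), (fullrankfun full).
have -> : mxsub (maxrankfun A) (fullrankfun full) A = (rowsub (fullrankfun full) B^T)^T.
  by apply/matrixP => i j; rewrite !mxE.
by rewrite det_tr -unitfE; apply: fullrowsub_unit.
Qed.

(** Only row spaces are compared, and the polynomial matrix may have any number of rows; this makes
    the notion stable under sums of spaces. *)
Definition polynomial_space (S : set T) (l N : nat) (U : T -> 'M[k]_(l, N)) :=
  exists (m : nat) (M : 'M[P]_(m, N)), forall q, S q -> (U q :=: map_mx (ev q) M)%MS.

(** At a point of maximal rank some minor of that size is nonzero. As a polynomial it is not
    identically zero on [S], so it vanishes at finitely many points only, and elsewhere the rank is
    maximal. *)
Lemma rank_generic (S : set T) l N (U : T -> 'M[k]_(l, N)) :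
  S !=set0 -> irreducible_pts S -> polynomial_space S U ->
  exists r, (forall q, S q -> (\rank (U q) <= r)%N) /\
    finite_set [set q | S q /\ (\rank (U q) < r)%N].
Proof.
move=> [q0 Sq0] irr [m [M HM]].
have ex : exists r, `[< exists2 q, S q & \rank (U q) = r >].
  by exists (\rank (U q0)); apply/asboolP; exists q0.
have bd r : `[< exists2 q, S q & \rank (U q) = r >] -> (r <= N)%N.
  by move=> /asboolP[q _ <-]; apply: rank_leq_col.
case: (ex_maxnP ex bd) => r /asboolP[q1 Sq1 rq1] max; exists r; split.
  by move=> q Sq; apply: max; apply/asboolP; exists q.
have [f [g]] := mxrank_minor (map_mx (ev q1) M).
rewrite -map_mxsub det_map_mx => nz.
have r1 : \rank (map_mx (ev q1) M) = r by rewrite -(HM _ Sq1).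
have [z|fin] := irr (\det (mxsub f g M)); first by rewrite z ?eqxx in nz.
apply: sub_finite_set fin => q [Sq]; rewrite (HM _ Sq) => lt; split=> //.
apply: contrapT => /eqP nzq; move: lt; rewrite ltnNge => /negP; apply.
rewrite -r1; apply: leq_trans (mxrank_mxsub f g _).
rewrite -map_mxsub; move: nzq; rewrite -det_map_mx -unitfE => unit.
by rewrite mxrank_unit.
Qed.

End Irreducible.

(** * Graded Tor and syzygies *)

Section FreeModule.
Variables (R : nzRingType) (I : choiceType).

Lemma malg_ind (G : zmodType) (Q : malg I G -> Prop) : Q 0 ->
  (forall x y, Q x -> Q y -> Q (x + y)) -> (forall i c, Q (mkmalgU i c)) ->
  forall f, Q f.
Proof. by move=> Q0 QD QU f; rewrite [f]monalgE; elim/big_rec: _ => // i x _; apply: QD. Qed.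

Lemma scale_malgU (a c : R) (i : I) : a *: mkmalgU i c = mkmalgU i (a * c).
Proof. by apply/malgP => y; rewrite mcoeffZ !mcoeffU mulrnAr. Qed.

Variables (V : lmodType R) (y : I -> V).

Definition malg_lift (f : malg I R) : V := \sum_(i <- msupp f) mcoeff i f *: y i.

Lemma malg_liftEw (f : malg I R) (D : {fset I}) : (msupp f `<=` D)%fset ->
  malg_lift f = \sum_(i <- D) mcoeff i f *: y i.
Proof.
move=> sD; apply: big_fset_incl => // i _.
by rewrite -mcoeff_eq0 => /eqP ->; rewrite scale0r.
Qed.

Fact malg_lift_linear : linear malg_lift.
Proof.
move=> a f g; pose D := (msupp (a *: f + g) `|` (msupp f `|` msupp g))%fset.
rewrite (@malg_liftEw _ D) ?fsubsetUl //.
rewrite (@malg_liftEw f D); last by rewrite /D fsetUCA fsubsetUl.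
rewrite (@malg_liftEw g D); last by rewrite /D fsetUA fsubsetUr.
rewrite scaler_sumr -big_split /=; apply: eq_bigr => i _.
by rewrite mcoeffD mcoeffZ scalerDl scalerA.
Qed.

HB.instance Definition _ :=
  GRing.isLinear.Build R (malg I R) V *:%R malg_lift malg_lift_linear.

Lemma malg_liftU i (a : R) : malg_lift (mkmalgU i a) = a *: y i.
Proof. by rewrite (malg_liftEw msuppU_le) big_seq_fset1 mcoeffUU. Qed.

End FreeModule.

Lemma malg_linear_eq (R : nzRingType) (I : choiceType) (V : lmodType R)
    (f g : {linear malg I R -> V}) :
  (forall i, f (mkmalgU i 1) = g (mkmalgU i 1)) -> f =1 g.
Proof.
move=> fg; apply: malg_ind => [|x y fx fy|i c]; first by rewrite !linear0.
  by rewrite !linearD fx fy.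
by rewrite -[c]mulr1 -scale_malgU !linearZ /= fg.
Qed.

(** * Comparison of free resolutions with the standard one *)

Section Comparison.
Variables (k : fieldType) (A : connGrAlg k).

(** This is A_+ K when [K] is a submodule. *)
Definition irr_span (M : lmodType A) (K : set M) : set M :=
  [set x | exists (N : nat) (a : nat -> A) (y : nat -> M),
     (forall l, irrelevant_ideal A (a l) /\ K (y l)) /\ x = \sum_(l < N) a l *: y l].

Lemma irr_span_gen (M : lmodType A) (K : set M) a x :
  irrelevant_ideal A a -> K x -> irr_span K (a *: x).
Proof. by move=> Ia Kx; exists 1%N, (fun=> a), (fun=> x); rewrite big_ord1. Qed.

Lemma irr_spanD (M : lmodType A) (K : set M) x y :
  irr_span K x -> irr_span K y -> irr_span K (x + y).
Proof.
move=> [m [a [u [Ha ->]]]] [n [b [v [Hb ->]]]].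
exists (m + n)%N, (fun l => if (l < m)%N then a l else b (l - m)%N),
  (fun l => if (l < m)%N then u l else v (l - m)%N); split.
  by move=> l; case: ifP.
rewrite big_split_ord /=; congr (_ + _); apply: eq_bigr => l _.
  by rewrite ltn_ord.
by rewrite ltnNge leq_addr /= addKn.
Qed.

Lemma irr_span0 (M : lmodType A) (K : set M) : K 0 -> irr_span K 0.
Proof. by move=> K0; rewrite -[0](scaler0 _ (0 : A)); apply: irr_span_gen => //; apply: irr0. Qed.

Lemma irr_spanN (M : lmodType A) (K : set M) x : irr_span K x -> irr_span K (- x).
Proof.
move=> [m [a [u [Ha ->]]]]; exists m, (fun l => - a l), u; split.
  by move=> l; have [Ia Ku] := Ha l; split=> //; apply: irrN.
by rewrite -sumrN; apply: eq_bigr => l _; rewrite scaleNr.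
Qed.

Lemma irr_span_linear (M N : lmodType A) (f : {linear M -> N}) (K : set M) (K' : set N) x :
  (forall y, K y -> K' (f y)) -> irr_span K x -> irr_span K' (f x).
Proof.
move=> fK [m [a [u [Ha ->]]]]; exists m, a, (f \o u); split.
  by move=> l; have [Ia Ku] := Ha l; split=> //; apply: fK.
by rewrite linear_sum; apply: eq_bigr => l _; rewrite linearZ.
Qed.

Lemma irrelevant_mulE (M : grModule A) : @irrelevant_mul k A M = irr_span setT.
Proof.
apply/seteqP; split=> x [N [a [y [Ha ->]]]]; exists N, a, y; split=> // l.
by have [] := Ha l.
Qed.

(** Take the component of degree [j] of any preimage; the other components map to components of [x]
    of other degrees, which are zero. *)
Lemma homogeneous_preimage (M N : grModule A) (f : {linear M -> N}) j x :
  degree_preserving f -> grm_comp j x -> range f x ->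
  exists2 y, grm_comp j y & f y = x.
Proof.
move=> df Gx [y _ fy].
have [n [u [Gu u0 su]]] := (hsumP (gr0 (grm_grading M)) y).1 (gr_span (grm_grading M) y).
pose m := maxn n j.+1; exists (u j) => //; apply/eqP; rewrite -subr_eq0; apply/eqP.
pose v l := f (u l) - (if l == j then x else 0).
have jm : (j < m)%N by rewrite leq_maxr.
have Gv l : grm_comp l (v l).
  apply: (grB (grm_grading N)); first exact: df.
  by case: eqP => [->//|_]; apply: gr0 (grm_grading N) _.
have := gr_direct (grm_grading N) (N := m) Gv _ jm; rewrite /v eqxx; apply.
rewrite sumrB -linear_sum -su ?leq_maxl // fy -big_mkcond /=.
by rewrite (big_pred1 (Ordinal jm)) ?subrr // => l; rewrite -val_eqE.
Qed.

(* Tor_(i+1)(k, k) = (Omega /\ A_+ P_i) / A_+ Omega for Omega = ker (P_i -> P_(i-1)). *)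
Lemma tor_syzygy i j (x : std_mod (trivial_grModule A) i) : ~ tor_neq0 A i.+1 j ->
  grm_comp j x -> stage_map (std_stage (trivial_grModule A) i) x = 0 ->
  irr_span setT x ->
  irr_span [set z | stage_map (std_stage (trivial_grModule A) i) z = 0] x.
Proof.
rewrite /tor_neq0 => /contrapT sub Gx Kx Ix.
set d := std_diff (trivial_grModule A) i; set K := [set z | _].
have dK w : K (d w) by rewrite /K -std_exact; exists w.
have [y Gy yx] : exists2 y, grm_comp j y & d y = x.
  by apply: homogeneous_preimage; [apply: std_deg i.+1|exact: Gx|rewrite std_exact].
have [_ [z _ Iz]] : tor_boundaries (P := standard_resolution (trivial_grModule A)) (i := i.+1) j y.
  by apply: sub; split; rewrite //= irrelevant_mulE -/d yx.
have dd : d (std_diff (trivial_grModule A) i.+1 z) = 0.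
  have : range (std_diff (trivial_grModule A) i.+1) (std_diff (trivial_grModule A) i.+1 z).
    by exists z.
  by rewrite std_exact.
move: Iz; rewrite irrelevant_mulE => Iz.
have := irr_span_linear (f := d) (K' := K) (fun w _ => dK w) Iz.
by rewrite linearB /= yx dd subr0.
Qed.

(** [K] and [K'] are the syzygies at one stage of two resolutions, and [F], [G] are chain maps at
    that stage. [phi] is what is needed of a homotopy between F G and the identity: it computes F G
    - 1 on [K'] and sends all of [Q] into [K']. *)
Record comparison (P : grModule A) (K : set P) (Q : lmodType A) (H : nat -> set Q)
    (K' : set Q) (F : {linear P -> Q}) (G : {linear Q -> P}) (phi : {linear Q -> Q}) :
    Prop := Comparison {
  cmpF : forall x, K x -> K' (F x);
  cmpG : forall x, K' x -> K (G x);
  cmp_deg : forall j x, H j x -> grm_comp j (G x);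
  cmp_phi : forall x, K' (phi x);
  cmpE : forall x, K' x -> F (G x) - x = phi x }.

(** Write x = F (G x) - phi x. The hypothesis on [P] puts G x in A_+ K, hence F (G x) in A_+ K'; and
    [phi] maps A_+ Q into A_+ K'. *)
Lemma comparison_tor (P : grModule A) (K : set P) (Q : lmodType A) H (K' : set Q) F G phi j :
  comparison K H K' F G phi ->
  (forall x : P, grm_comp j x -> K x -> irr_span setT x -> irr_span K x) ->
  forall x, H j x -> K' x -> irr_span setT x -> irr_span K' x.
Proof.
move=> [KF KG GH Kphi E] torP x Hx Kx Ix.
have -> : x = F (G x) + - phi x by rewrite -E // opprB addrCA subrr addr0.
apply: irr_spanD.
  by apply: (irr_span_linear KF); apply: torP; [apply: GH|apply: KG|apply: irr_span_linear Ix].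
by apply: irr_spanN; apply: irr_span_linear Ix => y _; apply: Kphi.
Qed.

Section FreeCover.
Variables (I : choiceType) (deg : I -> nat).

(** The homogeneous elements of degree [j] in the free module whose basis element [i] has degree
    [deg i]. *)
Inductive hfree (j : nat) : malg I A -> Prop :=
| HFree0 : hfree j 0
| HFreeD x y : hfree j x -> hfree j y -> hfree j (x + y)
| HFreeU p a i : cga_comp p a -> (p + deg i)%N = j -> hfree j (mkmalgU i a).

Lemma hfree_sum j (J : Type) (s : seq J) (p : pred J) (f : J -> malg I A) :
  (forall i, p i -> hfree j (f i)) -> hfree j (\sum_(i <- s | p i) f i).
Proof.
move=> Hf; elim/big_rec: _ => [|i x pi Hx]; first exact: HFree0.
by apply: HFreeD => //; apply: Hf.
Qed.

Lemma malg_projective (M N : lmodType A) (d : {linear M -> N}) (f : {linear malg I A -> N}) :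
  (forall x, range d (f x)) -> exists g : {linear malg I A -> M}, forall x, d (g x) = f x.
Proof.
move=> rf; have /choice[y Hy] : forall i, exists y, d y = f (mkmalgU i 1).
  by move=> i; have [y _ <-] := rf (mkmalgU i 1); exists y.
pose g : {linear malg I A -> M} := malg_lift y.
exists g => x; apply: (@malg_linear_eq _ _ _ (d \o g) f) => i /=.
by rewrite malg_liftU scale1r.
Qed.

(** [F1] and [G1] lift [F] and [G] along the two covers, and the new correction is F1 G1 - 1 - t d'.
    It lands in the kernel because d' (F1 G1 - 1) = (F G - 1) d' = phi d' = d' t d', and the term t
    d' disappears on the kernel. *)
Lemma comparison_step (P : grModule A) (K : set P) (Q : lmodType A) H (K' : set Q) F G phi
    (d' : {linear malg I A -> Q}) (t : {linear Q -> malg I A}) :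
  comparison K H K' F G phi -> range (cover_map K) = K ->
  range d' = K' -> (forall i, H (deg i) (d' (mkmalgU i 1))) ->
  (forall x, d' (t x) = phi x) ->
  exists F1 G1 phi1, comparison (P := cover K) [set x | cover_map K x = 0]
    hfree [set x | d' x = 0] F1 G1 phi1.
Proof.
move=> [KF KG GH Kphi E] rd rd' Hd' dt.
have Kd' x : K' (d' x) by rewrite -rd'; exists x.
have [F1 HF1] : exists F1 : {linear cover K -> malg I A}, forall x, d' (F1 x) = F (cover_map K x).
  have /choice[y Hy] : forall x : cover_index K, exists y, d' y = F (val x).1.
    move=> x; have Kx : K (val x).1 by have /asboolP[] := valP x.
    by have := KF _ Kx; rewrite -rd' => -[y _ <-]; exists y.
  pose g : {linear malg (cover_index K) A -> malg I A} := malg_lift y.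
  exists g => x; apply: (@malg_linear_eq _ _ _ (d' \o g) (F \o cover_map K)) => i /=.
  by rewrite malg_liftU (cover_mapU (K := K)) !scale1r.
(* The images of the basis elements are chosen homogeneous, which makes [G1] preserve degrees. *)
have [G1 [HG1 G1deg]] : exists G1 : {linear malg I A -> cover K},
    (forall x, cover_map K (G1 x) = G (d' x)) /\
    forall i, grm_comp (deg i) (G1 (mkmalgU i 1)).
  have /choice[y Hy] : forall i, exists y : cover K,
      grm_comp (deg i) y /\ cover_map K y = G (d' (mkmalgU i 1)).
    move=> i; have rG : range (cover_map K) (G (d' (mkmalgU i 1))) by rewrite rd; apply: KG.
    by have [y] := homogeneous_preimage (@cover_map_deg _ _ _ K) (GH _ _ (Hd' i)) rG; exists y.
  pose g : {linear malg I A -> cover K} := malg_lift y.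
  exists g; split=> [x|i]; last by rewrite /= malg_liftU scale1r; have [] := Hy i.
  apply: (@malg_linear_eq _ _ _ (cover_map K \o g) (G \o d')) => i /=.
  by rewrite malg_liftU scale1r; have [_ ->] := Hy i.
pose phi1 : {linear malg I A -> malg I A} := (F1 \o G1) \- idfun \- (t \o d').
exists F1, G1, phi1; split.
- by move=> x x0; apply: etrans (HF1 x) _; rewrite (x0 : cover_map K x = 0) linear0.
- by move=> x x0; apply: etrans (HG1 x) _; rewrite (x0 : d' x = 0) linear0.
- move=> j x; elim=> [|u v _ Hu _ Hv|p a i Ga <-].
  + by rewrite linear0; apply: gr0 (grm_grading (cover K)) _.
  + by rewrite linearD; apply: grD (grm_grading (cover K)) _ _ _ Hu Hv.
  + by rewrite -[a]mulr1 -scale_malgU linearZ; exact: (@grm_scale _ _ (cover K) _ _ _ _ Ga (G1deg i)).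
- move=> x; rewrite /mkset (_ : phi1 x = F1 (G1 x) - x - t (d' x)) //.
  by rewrite !linearB /= HF1 HG1 dt -E // subrr.
- move=> x x0; rewrite (_ : phi1 x = F1 (G1 x) - x - t (d' x)) //.
  by rewrite (x0 : d' x = 0) linear0 subr0.
Qed.

End FreeCover.

Definition free_aug : {linear malg unit A -> trivial_module A} :=
  malg_lift (fun _ : unit => (1 : k) : trivial_module A).

Local Notation ker f := [set x | f x = 0].
Local Notation T := (trivial_grModule A).

(** The comparison starts from the identity of the trivial module, with zero correction. *)
Lemma comparison0 : exists F G phi,
  comparison (P := std_mod T 0) (ker (stage_map (std_stage T 0)))
    (hfree (fun _ : unit => 0%N)) (ker free_aug) F G phi.
Proof.
pose z : {linear T -> T} := \0.
have C0 : comparison (P := T) setT (@trivial_comp k A) setT idfun idfun z.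
  by split=> // x _; rewrite subrr.
apply: (comparison_step (t := \0) C0) => //.
- exact: std_surj.
- apply/seteqP; split=> // c _; exists (mkmalgU tt c%:A) => //.
  rewrite /free_aug /= malg_liftU /GRing.scale /= /trivial_scale mulr1.
  by apply: augE; rewrite subrr; apply: irr0.
- by move=> x; rewrite linear0.
Qed.

Variables (I1 : choiceType) (deg1 : I1 -> nat) (d1 : {linear malg I1 A -> malg unit A}).
Hypothesis d1_deg : forall i, hfree (fun _ : unit => 0%N) (deg1 i) (d1 (mkmalgU i 1)).
Hypothesis d1_exact : range d1 = ker free_aug.

(** The correction of the previous stage has values in the range of [d1], so it lifts to the map [t]
    that [comparison_step] asks for. *)
Lemma comparison1 : exists F G phi,
  comparison (P := std_mod T 1) (ker (stage_map (std_stage T 1)))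
    (hfree deg1) (ker d1) F G phi.
Proof.
have [F [G [phi C]]] := comparison0.
have [t Ht] : exists t : {linear malg unit A -> malg I1 A}, forall x, d1 (t x) = phi x.
  by apply: malg_projective => x; rewrite d1_exact; apply: (cmp_phi C).
exact: (comparison_step C (std_exact T 0) d1_exact d1_deg Ht).
Qed.

Variables (I2 : choiceType) (deg2 : I2 -> nat) (d2 : {linear malg I2 A -> malg I1 A}).
Hypothesis d2_deg : forall i, hfree deg1 (deg2 i) (d2 (mkmalgU i 1)).
Hypothesis d2_exact : range d2 = ker d1.

Lemma comparison2 : exists F G phi,
  comparison (P := std_mod T 2) (ker (stage_map (std_stage T 2)))
    (hfree deg2) (ker d2) F G phi.
Proof.
have [F [G [phi C]]] := comparison1.
have [t Ht] : exists t : {linear malg I1 A -> malg I2 A}, forall x, d2 (t x) = phi x.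
  by apply: malg_projective => x; rewrite d2_exact; apply: (cmp_phi C).
exact: (comparison_step C (std_exact T 1) d2_exact d2_deg Ht).
Qed.

(** Here and in the next two lemmas [tor_syzygy] is carried over from the standard resolution to the
    free resolution of k that begins with [free_aug], [d1], [d2]. *)
Lemma tor1_syzygy j x : ~ tor_neq0 A 1 j -> hfree (fun _ : unit => 0%N) j x ->
  free_aug x = 0 -> irr_span setT x -> irr_span (ker free_aug) x.
Proof.
move=> tor; have [F [G [phi C]]] := comparison0.
exact: (comparison_tor C (fun x => tor_syzygy (x := x) tor)).
Qed.

Lemma tor2_syzygy j x : ~ tor_neq0 A 2 j -> hfree deg1 j x ->
  d1 x = 0 -> irr_span setT x -> irr_span (ker d1) x.
Proof.
move=> tor; have [F [G [phi C]]] := comparison1.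
exact: (comparison_tor C (fun x => tor_syzygy (x := x) tor)).
Qed.

Lemma tor3_syzygy j x : ~ tor_neq0 A 3 j -> hfree deg2 j x ->
  d2 x = 0 -> irr_span setT x -> irr_span (ker d2) x.
Proof.
move=> tor; have [F [G [phi C]]] := comparison2.
exact: (comparison_tor C (fun x => tor_syzygy (x := x) tor)).
Qed.

End Comparison.

Lemma m_bound (k : fieldType) (A : connGrAlg k) (i a j : nat) :
  (m_ A i <= (a%:Z)%:E)%E -> (a < j)%N -> ~ tor_neq0 A i j.
Proof.
rewrite /m_ /supremum => le aj tor.
have B : [set (j%:Z)%:E | j in [set j | tor_neq0 A i j]] (j%:Z)%:E by exists j.
move: le; case: ifPn => [/eqP E|_]; first by rewrite E in B.
set S := [set _ | _ in _] in B *.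
case: xgetP => [s _ [ub _] le|no].
  have := le_trans (ub _ B) le; rewrite lee_fin lez_nat leqNgt aj //.
(* The default value of [xget] cannot occur, since a supremum exists: the largest degree if the
   degrees are bounded, and +oo otherwise. *)
have [bd|nbd] := pselect (exists M, forall l, tor_neq0 A i l -> (l <= M)%N).
  have [M HM] := bd.
  have ex : exists l, `[< tor_neq0 A i l >] by exists j; apply/asboolP.
  have bd' l : `[< tor_neq0 A i l >] -> (l <= M)%N by move/asboolP; apply: HM.
  case: (ex_maxnP ex bd') => m /asboolP tm max.
  have [] := no (m%:Z)%:E; split=> [_ [l tl <-]|y]; last by apply; exists m.
  by rewrite lee_fin lez_nat; apply: max; apply/asboolP.
have [] := no +oo%E; split=> [y _|y uby]; first exact: leey.
rewrite leye_eq; case: y uby => [z||] uby //; last first.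
  by have := uby _ B; rewrite leeNy_eq.
exfalso; apply: nbd; exists `|z|%N => l tl.
have : ((l%:Z)%:E <= z%:E)%E by apply: uby; exists l.
by rewrite lee_fin => /le_trans/(_ (ler_norm z)); rewrite -abszE lez_nat.
Qed.

(** * Free algebras and presentations *)

Section Components.
Variables (V : zmodType) (G : nat -> set V) (gG : grading G).

(** Read off from an arbitrary finite decomposition; [component_unique] makes the choice
    immaterial. *)
Definition component (j : nat) (x : V) : V :=
  xget 0 [set z | exists (N : nat) (y : nat -> V),
    [/\ forall i, G i (y i), forall i, (N <= i)%N -> y i = 0,
        x = \sum_(i < N) y i & z = y j]].

Lemma component_unique (N M : nat) (y z : nat -> V) j :
  (forall i, G i (y i)) -> (forall i, (N <= i)%N -> y i = 0) ->
  (forall i, G i (z i)) -> (forall i, (M <= i)%N -> z i = 0) ->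
  \sum_(i < N) y i = \sum_(i < M) z i -> y j = z j.
Proof.
move=> Gy y0 Gz z0 E; apply/eqP; rewrite -subr_eq0; apply/eqP.
have ext n (u : nat -> V) m : (n <= m)%N -> (forall i, (n <= i)%N -> u i = 0) ->
    \sum_(i < m) u i = \sum_(i < n) u i.
  move=> nm u0; rewrite -(subnKC nm) big_split_ord /= [X in _ + X]big1 ?addr0 // => i _.
  by rewrite u0 ?leq_addr.
pose K := maxn (maxn N M) j.+1.
have NK : (N <= K)%N by rewrite /K; lia.
have MK : (M <= K)%N by rewrite /K; lia.
have jK : (j < K)%N by rewrite /K; lia.
apply: (gr_direct gG (N := K) (y := fun i => y i - z i)) => //.
  by move=> i; apply: (grB gG).
by rewrite sumrB (ext _ _ _ NK y0) (ext _ _ _ MK z0) E subrr.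
Qed.

Lemma component_spec x : exists N : nat, [/\ forall i, G i (component i x),
  forall i, (N <= i)%N -> component i x = 0 & x = \sum_(i < N) component i x].
Proof.
have [N [y [Gy y0 /(_ N (leqnn N)) Ex]]] := (hsumP (gr0 gG) x).1 (gr_span gG x).
have cE j : component j x = y j.
  rewrite /component; case: xgetP => [_ _ [M [z [Gz z0 Ez ->]]]|/(_ (y j))[]]; last by exists N, y.
  by apply: (component_unique j Gz z0 Gy y0); rewrite -Ez.
exists N; split=> [i|i|]; rewrite ?cE; [exact: Gy|exact: y0|].
by rewrite {1}Ex; apply: eq_bigr => i _; rewrite cE.
Qed.

Lemma component_in i x : G i (component i x).
Proof. by have [N []] := component_spec x. Qed.

Lemma componentE (N : nat) (y : nat -> V) j :
  (forall i, G i (y i)) -> (forall i, (N <= i)%N -> y i = 0) ->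
  component j (\sum_(i < N) y i) = y j.
Proof.
move=> Gy y0; have [M [Gc c0 Ec]] := component_spec (\sum_(i < N) y i).
by apply: (component_unique j Gc c0 Gy y0); rewrite -Ec.
Qed.

Lemma componentD j : {morph component j : x y / x + y}.
Proof.
move=> x y; have [N [Gx x0 Ex]] := component_spec x; have [M [Gy y0 Ey]] := component_spec y.
have xE : x = \sum_(i < maxn N M) component i x.
  rewrite {1}Ex -(subnKC (leq_maxl N M)) big_split_ord /= [X in _ + X]big1 ?addr0 // => i _.
  by rewrite x0 ?leq_addr.
have yE : y = \sum_(i < maxn N M) component i y.
  rewrite {1}Ey -(subnKC (leq_maxr N M)) big_split_ord /= [X in _ + X]big1 ?addr0 // => i _.
  by rewrite y0 ?leq_addr.
rewrite {1}xE {1}yE -big_split /=; apply: (componentE (y := fun i => component i x + component i y)).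
  by move=> i; apply: grD gG _ _ _ _ _.
by move=> i; rewrite geq_max => /andP[Ni Mi]; rewrite x0 // y0 // addr0.
Qed.

Lemma component_hom i j x : G i x -> component j x = if i == j then x else 0.
Proof.
move=> Gx; pose y l := if l == i then x else 0.
have -> : component j x = component j (\sum_(l < i.+1) y l).
  by rewrite /y -big_mkcond /= (big_pred1 (@ord_max i)) // => l; rewrite -val_eqE.
rewrite componentE /y; first by rewrite eq_sym.
  by move=> l; case: eqP => [->|_] //; apply: gr0 gG _.
by move=> l il; case: eqP => // li; rewrite li ltnn in il.
Qed.

End Components.

(** * The free algebra, its Fox derivatives and its grading by weight *)

Section FreeAlgebra.
Variables (k : fieldType) (n : nat).

Lemma mkmalgUM (u v : fmonom 'I_n) (a b : k) :
  mkmalgU u a * mkmalgU v b = mkmalgU (mul u v) (a * b) :> malg (fmonom 'I_n) k.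
Proof. exact: (fgmulUU (K := fmonom 'I_n) (R := k)). Qed.

Lemma bilinear_malg_eq (K : choiceType) (G V : zmodType) (b b' : malg K G -> malg K G -> V) :
  (forall f f' g, b (f + f') g = b f g + b f' g) ->
  (forall f g g', b f (g + g') = b f g + b f g') ->
  (forall f f' g, b' (f + f') g = b' f g + b' f' g) ->
  (forall f g g', b' f (g + g') = b' f g + b' f g') ->
  (forall u v c e, b (mkmalgU u c) (mkmalgU v e) = b' (mkmalgU u c) (mkmalgU v e)) ->
  forall f g, b f g = b' f g.
Proof.
move=> bDl bDr b'Dl b'Dr E f g.
have b0l h : b 0 h = 0 by apply: (addrI (b 0 h)); rewrite -bDl !addr0.
have b0r h : b h 0 = 0 by apply: (addrI (b h 0)); rewrite -bDr !addr0.
have b'0l h : b' 0 h = 0 by apply: (addrI (b' 0 h)); rewrite -b'Dl !addr0.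
have b'0r h : b' h 0 = 0 by apply: (addrI (b' h 0)); rewrite -b'Dr !addr0.
elim/malg_ind: f => [|f f' IH IH'|u c]; first by rewrite b0l b'0l.
  by rewrite bDl b'Dl IH IH'.
elim/malg_ind: g => [|g g' IH IH'|v e]; [by rewrite b0r b'0r| |exact: E].
by rewrite bDr b'Dr IH IH'.
Qed.

Definition word_alg : Type := malg (fmonom 'I_n) k.

HB.instance Definition _ := GRing.Lalgebra.on word_alg.

Fact word_alg_scaleAr (c : k) (f g : word_alg) : c *: (f * g) = f * (c *: g).
Proof.
apply: (@bilinear_malg_eq _ _ _ (fun f g : word_alg => c *: (f * g))
  (fun f g : word_alg => f * (c *: g))).
- by move=> *; rewrite mulrDl scalerDr.
- by move=> *; rewrite mulrDr scalerDr.
- by move=> *; rewrite mulrDl.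
- by move=> *; rewrite scalerDr mulrDr.
move=> u v a b; etransitivity; first by apply: congr1; apply: mkmalgUM.
etransitivity; first exact: scale_malgU.
symmetry; etransitivity; first by apply: congr1; apply: scale_malgU.
by etransitivity; first exact: mkmalgUM; rewrite mulrCA.
Qed.

HB.instance Definition _ := GRing.Lalgebra_isAlgebra.Build k word_alg word_alg_scaleAr.

(* An interface to [word_alg] that hides the implementation from unification. *)
Record freeAlgebra := FreeAlgebra {
  fa_sort :> algType k;
  fa_wd : seq 'I_n -> fa_sort;
  fa_lin : forall V : lmodType k, (seq 'I_n -> V) -> {linear fa_sort -> V};
  wd_nil : fa_wd [::] = 1;
  wdM : forall u v, fa_wd u * fa_wd v = fa_wd (u ++ v);
  lin_wd : forall (V : lmodType k) (h : seq 'I_n -> V) w, fa_lin h (fa_wd w) = h w;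
  free_ind : forall Q : fa_sort -> Prop, Q 0 -> (forall f g, Q f -> Q g -> Q (f + g)) ->
    (forall (c : k) w, Q (c *: fa_wd w)) -> forall f, Q f }.

Lemma freeAlgebra_exists : inhabited freeAlgebra.
Proof.
pose w u : word_alg := mkmalgU (FMonom u) 1.
pose l (V : lmodType k) (h : seq 'I_n -> V) : {linear word_alg -> V} :=
  malg_lift (fun m : fmonom 'I_n => h m).
constructor; apply: (@FreeAlgebra word_alg w l).
- by rewrite /w -fmoneE.
- move=> u v; etransitivity; first exact: mkmalgUM.
  by rewrite mulr1 /mul /= fmmulE.
- by move=> V h u; rewrite /l /= malg_liftU scale1r.
- move=> Q Q0 QD QU; apply: malg_ind => // m c.
  by have := QU c m; rewrite /w scale_malgU mulr1; case: m.
Qed.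

Variables (F : freeAlgebra) (d : 'I_n -> nat).
Implicit Types (f g : F) (u v w : seq 'I_n).
Local Notation wd := (fa_wd F).
Local Notation lin := (fa_lin F).

Definition X i : F := wd [:: i].
Definition wt w : nat := \sum_(i <- w) d i.

Lemma wt_cat u v : wt (u ++ v) = (wt u + wt v)%N.
Proof. by rewrite /wt big_cat. Qed.

Lemma wt_rcons u i : wt (rcons u i) = (wt u + d i)%N.
Proof. by rewrite -cats1 wt_cat /wt big_seq1. Qed.

Lemma wt_cons u i : wt (i :: u) = (d i + wt u)%N.
Proof. by rewrite -cat1s wt_cat /wt big_seq1. Qed.

Lemma free_mul_ind (V : zmodType) (b b' : F -> F -> V) :
  (forall f f' g, b (f + f') g = b f g + b f' g) ->
  (forall f g g', b f (g + g') = b f g + b f g') ->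
  (forall f f' g, b' (f + f') g = b' f g + b' f' g) ->
  (forall f g g', b' f (g + g') = b' f g + b' f g') ->
  (forall (c e : k) u v, b (c *: wd u) (e *: wd v) = b' (c *: wd u) (e *: wd v)) ->
  forall f g, b f g = b' f g.
Proof.
move=> bDl bDr b'Dl b'Dr E f g.
have b0l h : b 0 h = 0 by apply: (addrI (b 0 h)); rewrite -bDl !addr0.
have b0r h : b h 0 = 0 by apply: (addrI (b h 0)); rewrite -bDr !addr0.
have b'0l h : b' 0 h = 0 by apply: (addrI (b' 0 h)); rewrite -b'Dl !addr0.
have b'0r h : b' h 0 = 0 by apply: (addrI (b' h 0)); rewrite -b'Dr !addr0.
elim/free_ind: f => [|f f' IH IH'|c u]; first by rewrite b0l b'0l.
  by rewrite bDl b'Dl IH IH'.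
elim/free_ind: g => [|g g' IH IH'|e v]; [by rewrite b0r b'0r| |exact: E].
by rewrite bDr b'Dr IH IH'.
Qed.

Definition cst : {linear F -> k^o} := lin (fun w => (w == [::])%:R : k^o).

(** Deleting a final letter [i], or an initial one for [ld], extends linearly to [rder] and [lder].
    The maps [rder i] are the Fox derivatives. *)
Definition rd i w : F :=
  if w is a :: s then if last a s == i then wd (belast a s) else 0 else 0.
Definition ld i w : F := if w is a :: s then if a == i then wd s else 0 else 0.
Definition rder i : {linear F -> F} := lin (rd i).
Definition lder i : {linear F -> F} := lin (ld i).
Definition hpart j : {linear F -> F} := lin (fun w => if wt w == j then wd w else 0).

Lemma rd_rcons i w a : rd i (rcons w a) = if a == i then wd w else 0.
Proof. by case: w => //= b w; rewrite last_rcons belast_rcons. Qed.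

Lemma cstM f g : cst (f * g) = cst f * cst g.
Proof.
apply: (free_mul_ind (b := fun f g => cst (f * g)) (b' := fun f g => cst f * cst g)).
- by move=> *; rewrite mulrDl linearD.
- by move=> *; rewrite mulrDr linearD.
- by move=> *; rewrite linearD mulrDl.
- by move=> *; rewrite linearD mulrDr.
move=> c e u v; rewrite -scalerAl -scalerAr wdM !linearZ /= !lin_wd.
by rewrite -scalerAl -scalerAr; case: u => [|a u]; rewrite /= ?mul1r ?mul0r.
Qed.

(** Fox's product rule, checked on words: the last letter of a product belongs to the second factor
    unless that factor is the empty word. *)
Lemma rderM i f g : rder i (f * g) = f * rder i g + cst g *: rder i f.
Proof.
apply: (free_mul_ind (b := fun f g => rder i (f * g))
  (b' := fun f g => f * rder i g + cst g *: rder i f)).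
- by move=> *; rewrite mulrDl linearD.
- by move=> *; rewrite mulrDr linearD.
- by move=> *; rewrite mulrDl linearD scalerDr addrACA.
- by move=> *; rewrite !linearD mulrDr scalerDl addrACA.
move=> c e u v; rewrite -scalerAl -scalerAr wdM !linearZ /= !lin_wd.
case/lastP: v => [|v a].
  rewrite cats0 /= scaler0 mulr0 add0r.
  by congr (_ *: (_ *: _)); exact: esym (mulr1 e).
rewrite -rcons_cat !rd_rcons -size_eq0 size_rcons /=.
rewrite scaler0 scale0r scaler0 addr0 -scalerAl -scalerAr.
by case: eqP => _; rewrite ?wdM ?mulr0.
Qed.

Lemma rder_decomp f : f = (cst f)%:A + \sum_i rder i f * X i.
Proof.
elim/free_ind: f => [|f g IHf IHg|c w].
- by rewrite linear0 scale0r add0r big1 // => i _; rewrite linear0 mul0r.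
- rewrite linearD scalerDl; under eq_bigr do rewrite linearD mulrDl.
  by rewrite big_split /= addrACA -IHf -IHg.
rewrite linearZ /= lin_wd; under eq_bigr do rewrite linearZ /= lin_wd -scalerAl.
rewrite -scaler_sumr -scalerA -scalerDr; congr (_ *: _).
case/lastP: w => [|w a].
  by rewrite eqxx scale1r big1 ?addr0 ?wd_nil // => i _; rewrite mul0r.
rewrite -size_eq0 size_rcons scale0r add0r (bigD1 a) //= rd_rcons eqxx.
by rewrite wdM cats1 big1 ?addr0 // => i ia; rewrite rd_rcons eq_sym (negPf ia) mul0r.
Qed.

Lemma lder_decomp f : f = (cst f)%:A + \sum_i X i * lder i f.
Proof.
elim/free_ind: f => [|f g IHf IHg|c w].
- by rewrite linear0 scale0r add0r big1 // => i _; rewrite linear0 mulr0.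
- rewrite linearD scalerDl; under eq_bigr do rewrite linearD mulrDr.
  by rewrite big_split /= addrACA -IHf -IHg.
rewrite linearZ /= lin_wd; under eq_bigr do rewrite linearZ /= lin_wd -scalerAr.
rewrite -scaler_sumr -scalerA -scalerDr; congr (_ *: _).
case: w => [|a w].
  by rewrite eqxx scale1r big1 ?addr0 ?wd_nil // => i _; rewrite mulr0.
rewrite /= scale0r add0r (bigD1 a) //= eqxx.
by rewrite wdM /= big1 ?addr0 // => i ia; rewrite eq_sym (negPf ia) mulr0.
Qed.

Lemma rder_hpart i j f : rder i (hpart j f) =
  if (d i <= j)%N then hpart (j - d i)%N (rder i f) else 0.
Proof.
elim/free_ind: f => [|f g IHf IHg|c w]; first by rewrite !linear0 if_same.
  by rewrite !linearD IHf IHg; case: ifP => _; rewrite ?addr0.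
rewrite !linearZ /= !lin_wd.
have -> : rder i (if wt w == j then wd w else 0) = if wt w == j then rd i w else 0.
  by case: ifP => _; rewrite ?lin_wd ?linear0.
case/lastP: w => [|w a]; first by rewrite /= linear0 !if_same scaler0 if_same.
rewrite rd_rcons wt_rcons; case: (eqVneq a i) => [->|_]; last first.
  by rewrite linear0 !if_same scaler0 if_same.
rewrite lin_wd; case: (leqP (d i) j) => dj.
  by rewrite -[X in _ == X](subnK dj) eqn_add2r.
case: eqP => [E|_]; last by rewrite scaler0.
by rewrite -E ltnNge leq_addl in dj.
Qed.

Lemma hpart_mulX i j f : hpart j (X i * f) =
  if (d i <= j)%N then X i * hpart (j - d i)%N f else 0.
Proof.
elim/free_ind: f => [|f g IHf IHg|c w]; first by rewrite mulr0 !linear0 mulr0 if_same.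
  by rewrite mulrDr !linearD IHf IHg mulrDr; case: ifP => _; rewrite ?addr0.
rewrite -scalerAr wdM !linearZ /= !lin_wd -scalerAr wt_cons.
case: (leqP (d i) j) => dj.
  rewrite -[in LHS](subnKC dj) eqn_add2l; case: eqP => _; last by rewrite mulr0.
  by rewrite wdM.
case: eqP => [E|_]; last by rewrite scaler0.
by rewrite -E ltnNge leq_addr in dj.
Qed.

Lemma hpart_Xmul i j f : hpart j (f * X i) =
  if (d i <= j)%N then hpart (j - d i)%N f * X i else 0.
Proof.
elim/free_ind: f => [|f g IHf IHg|c w]; first by rewrite mul0r !linear0 mul0r if_same.
  by rewrite mulrDl !linearD IHf IHg mulrDl; case: ifP => _; rewrite ?addr0.
rewrite -scalerAl wdM !linearZ /= !lin_wd -scalerAl cats1 wt_rcons.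
case: (leqP (d i) j) => dj.
  rewrite -[in LHS](subnK dj) eqn_add2r; case: eqP => _; last by rewrite mul0r.
  by rewrite wdM cats1.
case: eqP => [E|_]; last by rewrite scaler0.
by rewrite -E ltnNge leq_addl in dj.
Qed.

Lemma hpart_hpart i j f : hpart i (hpart j f) = if i == j then hpart j f else 0.
Proof.
elim/free_ind: f => [|f g IHf IHg|c w]; first by rewrite !linear0 if_same.
  by rewrite !linearD IHf IHg; case: ifP => _; rewrite ?addr0.
rewrite !linearZ /= !lin_wd; case: (eqVneq (wt w) j) => [E|_].
  by rewrite lin_wd E eq_sym; case: eqP => _; rewrite ?scaler0.
by rewrite linear0 scaler0 if_same.
Qed.

Lemma hpart_sum f : exists N, f = \sum_(j < N) hpart j f.
Proof.
suff [N HN] : exists N, forall M, (N <= M)%N -> f = \sum_(j < M) hpart j f by exists N; apply: HN.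
elim/free_ind: f => [|f g [N HN] [M HM]|c w].
- by exists 0%N => M _; rewrite big1 // => i _; rewrite linear0.
- exists (maxn N M) => K; rewrite geq_max => /andP[NK MK].
  by under eq_bigr do rewrite linearD; rewrite big_split /= -HN // -HM.
exists (wt w).+1 => M wM; rewrite (bigD1 (Ordinal wM)) //= linearZ /= lin_wd eqxx.
rewrite big1 ?addr0 // => j; rewrite -val_eqE /= => jw; rewrite linearZ /= lin_wd.
by rewrite eq_sym (negPf jw) scaler0.
Qed.

End FreeAlgebra.

(** * Presentations and Govorov's formulas *)

Section Presentation.
Variables (k : fieldType) (A : connGrAlg k) (n : nat) (F : freeAlgebra k n).
Variables (d : 'I_n -> nat) (x : 'I_n -> A).
Hypothesis d_gt0 : forall i, (0 < d i)%N.
Hypothesis x_deg : forall i, cga_comp (d i) (x i).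
Implicit Types (f g : F).

Local Notation irr := (irrelevant_ideal A).
Local Notation ker f := [set z | f z = 0].
Local Notation gA := (cga_grading A).
Local Notation pr j := (component (@cga_comp k A) j).

Lemma cga_scale (c : k) i (a : A) : cga_comp i a -> cga_comp i (c *: a).
Proof.
move=> Ga; rewrite -[c *: a]mulr_algl -[i]add0n; apply: cga_mul => //.
by rewrite cga_connected; exists c.
Qed.

Lemma irr_homogeneous i (a : A) : (0 < i)%N -> cga_comp i a -> irr a.
Proof. by case: i => // i _; apply: irr_hom. Qed.

Definition eval_word (w : seq 'I_n) : A := \prod_(i <- w) x i.

Definition phi : {linear F -> A} := fa_lin F eval_word.

Lemma phi_wd w : phi (fa_wd F w) = eval_word w.
Proof. exact: lin_wd. Qed.

Lemma phiM f g : phi (f * g) = phi f * phi g.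
Proof.
apply: (free_mul_ind (b := fun f g => phi (f * g)) (b' := fun f g => phi f * phi g)).
- by move=> *; rewrite mulrDl linearD.
- by move=> *; rewrite mulrDr linearD.
- by move=> *; rewrite linearD mulrDl.
- by move=> *; rewrite linearD mulrDr.
move=> c e u v; rewrite -scalerAl -scalerAr wdM !linearZ /= !phi_wd.
by rewrite -scalerAl -scalerAr /eval_word big_cat.
Qed.

Lemma phiX i : phi (X F i) = x i.
Proof. by rewrite phi_wd /eval_word big_seq1. Qed.

Lemma phi1 : phi 1 = 1.
Proof. by rewrite -wd_nil phi_wd /eval_word big_nil. Qed.

Lemma eval_word_deg w : cga_comp (wt d w) (eval_word w).
Proof.
elim: w => [|i w IH]; first by rewrite /wt /eval_word !big_nil; apply: cga_comp1.
by rewrite wt_cons /eval_word big_cons; apply: cga_mul.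
Qed.

Lemma phi_hpart j f : phi (hpart F d j f) = pr j (phi f).
Proof.
elim/free_ind: f => [|f g IHf IHg|c w].
- rewrite !linear0; symmetry; rewrite (component_hom gA (i := j)) ?eqxx //.
  exact: gr0 gA _.
- by rewrite !linearD (componentD gA) IHf IHg.
rewrite !linearZ /= lin_wd phi_wd.
rewrite (component_hom gA (i := wt d w)); last by apply: cga_scale; apply: eval_word_deg.
by case: eqP => _; rewrite ?phi_wd // linear0 scaler0.
Qed.

Lemma phi_hpart_deg j f : cga_comp j (phi (hpart F d j f)).
Proof. by rewrite phi_hpart; apply: component_in gA _ _. Qed.

Lemma hpart_ker j f : phi f = 0 -> phi (hpart F d j f) = 0.
Proof.
move=> f0; rewrite phi_hpart f0 (component_hom gA (i := j)) ?eqxx //; exact: gr0 gA _.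
Qed.

Lemma phi_cst f : irr (phi f - (cst F f)%:A).
Proof.
rewrite [X in phi X](rder_decomp f) linearD linearZ /= phi1 addrAC subrr add0r.
rewrite linear_sum; apply: irr_sum => i _; rewrite phiM phiX; apply: irrMl.
exact: irr_homogeneous (x_deg i).
Qed.

Lemma cst_irr f : irr (phi f) -> cst F f = 0.
Proof.
move=> If; apply: (@irr_scal _ A).
have -> : (cst F f)%:A = phi f - (phi f - (cst F f)%:A) :> A by rewrite opprB addrCA subrr addr0.
by apply: irrD => //; apply: irrN; apply: phi_cst.
Qed.

Lemma cst_ker f : phi f = 0 -> cst F f = 0.
Proof. by move=> f0; apply: cst_irr; rewrite f0; apply: irr0. Qed.

Lemma rder_decomp0 f : cst F f = 0 -> f = \sum_i rder F i f * X F i.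
Proof. by move=> f0; rewrite {1}(rder_decomp f) f0 scale0r add0r. Qed.

Lemma lder_decomp0 f : cst F f = 0 -> f = \sum_i X F i * lder F i f.
Proof. by move=> f0; rewrite {1}(lder_decomp f) f0 scale0r add0r. Qed.

(** With I the kernel of [phi], [XI] is F_+ I and [IX] is I F_+. Multiplying by single letters
    suffices because I is a two-sided ideal. *)
Definition XI : set F :=
  [set f | exists2 r : 'I_n -> F, forall i, phi (r i) = 0 & f = \sum_i X F i * r i].
Definition IX : set F :=
  [set f | exists2 r : 'I_n -> F, forall i, phi (r i) = 0 & f = \sum_i r i * X F i].

(** The space I I + F_+ I F_+ from the formula for Tor_3; again single outer letters suffice. *)
Inductive overlap : F -> Prop :=
| OverlapD f g : overlap f -> overlap g -> overlap (f + g)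
| OverlapM f g : phi f = 0 -> phi g = 0 -> overlap (f * g)
| OverlapX i j f : phi f = 0 -> overlap (X F i * f * X F j).

Lemma overlap0 : overlap 0.
Proof. by rewrite -[0](mulr0 (0 : F)); apply: OverlapM; rewrite linear0. Qed.

Lemma overlapN f : overlap f -> overlap (- f).
Proof.
elim=> [u v _ Hu _ Hv|u v u0 v0|i j u u0].
- by rewrite opprD; apply: OverlapD.
- by rewrite -mulNr; apply: OverlapM; rewrite ?linearN /= ?u0 ?oppr0.
- by rewrite -mulNr -mulrN; apply: OverlapX; rewrite linearN /= u0 oppr0.
Qed.

Lemma overlap_sum (J : Type) (s : seq J) (P : pred J) (f : J -> F) :
  (forall i, P i -> overlap (f i)) -> overlap (\sum_(i <- s | P i) f i).
Proof.
move=> Hf; elim/big_rec: _ => [|i y Pi Hy]; first exact: overlap0.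
by apply: OverlapD => //; apply: Hf.
Qed.

Lemma XID f g : XI f -> XI g -> XI (f + g).
Proof.
move=> [r r0 ->] [s s0 ->]; exists (fun i => r i + s i) => [i|].
  by rewrite linearD /= r0 s0 addr0.
by rewrite -big_split; apply: eq_bigr => i _; rewrite mulrDr.
Qed.

Lemma IXD f g : IX f -> IX g -> IX (f + g).
Proof.
move=> [r r0 ->] [s s0 ->]; exists (fun i => r i + s i) => [i|].
  by rewrite linearD /= r0 s0 addr0.
by rewrite -big_split; apply: eq_bigr => i _; rewrite mulrDl.
Qed.

Lemma XI_mul f g : cst F f = 0 -> phi g = 0 -> XI (f * g).
Proof.
move=> f0 g0; exists (fun i => lder F i f * g); first by move=> i; rewrite phiM g0 mulr0.
by rewrite {1}(lder_decomp0 f0) mulr_suml; apply: eq_bigr => i _; rewrite mulrA.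
Qed.

Lemma IX_mul f g : phi f = 0 -> cst F g = 0 -> IX (f * g).
Proof.
move=> f0 g0; exists (fun i => f * rder F i g); first by move=> i; rewrite phiM f0 mul0r.
by rewrite {1}(rder_decomp0 g0) mulr_sumr; apply: eq_bigr => i _; rewrite mulrA.
Qed.

Lemma cstX i : cst F (X F i) = 0.
Proof. exact: lin_wd. Qed.

Lemma overlap_XI f : overlap f -> XI f.
Proof.
elim=> [u v _ Hu _ Hv|u v u0 v0|i j u u0]; first exact: XID.
  by apply: XI_mul => //; apply: cst_ker.
by rewrite -mulrA; apply: XI_mul; rewrite ?cstX // phiM u0 mul0r.
Qed.

Lemma overlap_IX f : overlap f -> IX f.
Proof.
elim=> [u v _ Hu _ Hv|u v u0 v0|i j u u0]; first exact: IXD.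
  by apply: IX_mul => //; apply: cst_ker.
by apply: IX_mul; rewrite ?cstX // phiM u0 mulr0.
Qed.

Lemma XI_ker f : XI f -> phi f = 0.
Proof.
by move=> [r r0 ->]; rewrite linear_sum big1 // => i _; rewrite phiM r0 mulr0.
Qed.

Lemma IX_ker f : IX f -> phi f = 0.
Proof.
by move=> [r r0 ->]; rewrite linear_sum big1 // => i _; rewrite phiM r0 mul0r.
Qed.

Lemma XI_hpart j f : XI f -> XI (hpart F d j f).
Proof.
move=> [r r0 ->]; exists (fun i => if (d i <= j)%N then hpart F d (j - d i)%N (r i) else 0).
  by move=> i; case: ifP => _; rewrite ?linear0 // hpart_ker.
rewrite linear_sum; apply: eq_bigr => i _; rewrite hpart_mulX.
by case: ifP => _; rewrite ?mulr0.
Qed.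

Lemma IX_hpart j f : IX f -> IX (hpart F d j f).
Proof.
move=> [r r0 ->]; exists (fun i => if (d i <= j)%N then hpart F d (j - d i)%N (r i) else 0).
  by move=> i; case: ifP => _; rewrite ?linear0 // hpart_ker.
rewrite linear_sum; apply: eq_bigr => i _; rewrite hpart_Xmul.
by case: ifP => _; rewrite ?mul0r.
Qed.

(* The class of [f] in [A (x) V], for [V] spanned by the generators. *)
Definition omega f : malg 'I_n A := \sum_i mkmalgU i (phi (rder F i f)).

Lemma mcoeff_omega i f : mcoeff i (omega f) = phi (rder F i f).
Proof.
rewrite /omega raddf_sum (bigD1 i) //= mcoeffUU big1 ?addr0 // => j ji.
by rewrite mcoeffU (negPf ji).
Qed.

Lemma omegaD : {morph omega : f g / f + g}.
Proof. by move=> f g; apply/malgP => i; rewrite mcoeffD !mcoeff_omega !linearD. Qed.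

Lemma omega0 : omega 0 = 0.
Proof. by apply/malgP => i; rewrite mcoeff0 mcoeff_omega !linear0. Qed.

Lemma omegaN f : omega (- f) = - omega f.
Proof. by apply/malgP => i; rewrite mcoeffN !mcoeff_omega !linearN. Qed.

Lemma omega_sum (J : Type) (s : seq J) (P : pred J) (f : J -> F) :
  omega (\sum_(i <- s | P i) f i) = \sum_(i <- s | P i) omega (f i).
Proof. exact: (big_morph omega omegaD omega0). Qed.

(** By Fox's rule, [omega] restricted to F_+ is linear over F, which acts on A (x) V through
    [phi]. *)
Lemma omegaM f g : cst F g = 0 -> omega (f * g) = phi f *: omega g.
Proof.
by move=> g0; apply/malgP => i; rewrite mcoeffZ !mcoeff_omega rderM g0 scale0r addr0 phiM.
Qed.

Lemma omegaX i : omega (X F i) = mkmalgU i 1.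
Proof.
apply/malgP => j; rewrite mcoeff_omega mcoeffU lin_wd /=.
by case: eqP => _; rewrite ?linear0 // wd_nil phi1.
Qed.

(** Together with [IX_omega] and [omega_surj] this identifies F_+ / I F_+ with A (x) V. *)
Lemma omega_IX f : cst F f = 0 -> omega f = 0 -> IX f.
Proof.
move=> c0 w0; exists (fun i => rder F i f); last exact: rder_decomp0.
by move=> i; rewrite -mcoeff_omega w0 mcoeff0.
Qed.

Lemma IX_omega f : IX f -> omega f = 0.
Proof.
move=> [r r0 ->]; rewrite omega_sum big1 // => i _.
by rewrite omegaM ?cstX // r0 scale0r.
Qed.

Lemma omega_deg j f : hpart F d j f = f -> hfree d j (omega f).
Proof.
move=> fj; apply: hfree_sum => i _; rewrite -fj rder_hpart.
case: leqP => [dj|_]; last by rewrite linear0 raddf0; apply: HFree0.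
by apply: HFreeU (subnK dj); apply: phi_hpart_deg.
Qed.

Local Notation deg0 := (fun _ : unit => 0%N).

(** The multiplication map A (x) V -> A. By [diff1_omega] it corresponds to [phi] on F_+. *)
Definition diff1 : {linear malg 'I_n A -> malg unit A} := malg_lift (fun i => mkmalgU tt (x i)).

Lemma diff1_omega f : cst F f = 0 -> diff1 (omega f) = mkmalgU tt (phi f).
Proof.
move=> f0; rewrite /omega linear_sum.
rewrite [in RHS](rder_decomp0 f0) linear_sum raddf_sum; apply: eq_bigr => i _.
by rewrite /diff1 /= malg_liftU scale_malgU phiM phiX.
Qed.

Lemma mkmalgU_unit (y : malg unit A) : y = mkmalgU tt (mcoeff tt y).
Proof. by apply/malgP => -[]; rewrite mcoeffUU. Qed.

Lemma mkmalgU_inj0 (a : A) : mkmalgU tt a = 0 -> a = 0.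
Proof. by move/(congr1 (mcoeff tt)); rewrite mcoeffUU mcoeff0. Qed.

Lemma free_augU (a : A) : free_aug A (mkmalgU tt a) = 0 <-> irr a.
Proof.
rewrite /free_aug /= malg_liftU /GRing.scale /= /trivial_scale mulr1; split.
  by move=> E; have := augP a; rewrite E scale0r subr0.
exact: aug_irr.
Qed.

Hypothesis phi_surj : forall a, exists f, phi f = a.

Lemma omega_surj (y : malg 'I_n A) : exists f, cst F f = 0 /\ omega f = y.
Proof.
have [f Hf] := choice (fun i => phi_surj (mcoeff i y)).
exists (\sum_i f i * X F i); split.
  by rewrite linear_sum big1 // => i _; rewrite cstM cstX mulr0.
apply/malgP => i; rewrite omega_sum raddf_sum (bigD1 i) //= big1 => [|j ji].
  by rewrite omegaM ?cstX // omegaX mcoeffZ mcoeffUU mulr1 addr0.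
by rewrite omegaM ?cstX // omegaX mcoeffZ mcoeffU (negPf ji) mulr0.
Qed.

(** Hence the kernel of [diff1] is I / I F_+. *)
Lemma diff1_ker (y : malg 'I_n A) : diff1 y = 0 -> exists f, phi f = 0 /\ omega f = y.
Proof.
have [f [f0 <-]] := omega_surj y; rewrite diff1_omega // => /mkmalgU_inj0 E.
by exists f.
Qed.

Lemma diff1_deg i : hfree deg0 (d i) (diff1 (mkmalgU i 1)).
Proof.
by rewrite /diff1 /= malg_liftU scale1r; apply: HFreeU (x_deg i) _; rewrite addn0.
Qed.

Lemma diff1_exact : range diff1 = ker (free_aug A).
Proof.
apply/seteqP; split=> [_ [y _ <-]|y].
  rewrite /mkset; apply: (malg_ind (Q := fun y => free_aug A (diff1 y) = 0)) => [|u v u0 v0|i c].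
  - by rewrite !linear0.
  - by rewrite !linearD u0 v0 addr0.
  rewrite /diff1 /= malg_liftU scale_malgU; apply/free_augU.
  by apply: irrMl; apply: irr_homogeneous (x_deg i).
rewrite /mkset (mkmalgU_unit y) => /free_augU; have [f <-] := phi_surj (mcoeff tt y).
by move=> /cst_irr f0; exists (omega f) => //; rewrite diff1_omega.
Qed.

(** All homogeneous relations, each with its degree recorded because 0 has every degree. They index
    the basis of the next free module, so that no minimal relations have to be picked. *)
Definition relation : choiceType :=
  {r : (F : choiceType) * nat | `[< hpart F d r.2 r.1 = r.1 /\ phi r.1 = 0 >]}.

Definition rel_deg (r : relation) : nat := (val r).2.
Definition rel_val (r : relation) : F := (val r).1.

Lemma rel_valP r : hpart F d (rel_deg r) (rel_val r) = rel_val r /\ phi (rel_val r) = 0.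
Proof. exact/asboolP/(valP r). Qed.

Lemma relation_of j f : hpart F d j f = f -> phi f = 0 ->
  exists r, rel_deg r = j /\ rel_val r = f.
Proof.
move=> fj f0; have H : `[< hpart F d (f, j).2 (f, j).1 = (f, j).1 /\ phi (f, j).1 = 0 >].
  by apply/asboolP.
by exists (exist _ (f, j) H).
Qed.

Definition diff2 : {linear malg relation A -> malg 'I_n A} :=
  malg_lift (fun r => omega (rel_val r)).

Lemma diff2_deg r : hfree d (rel_deg r) (diff2 (mkmalgU r 1)).
Proof.
by rewrite /diff2 /= malg_liftU scale1r; apply: omega_deg; have [] := rel_valP r.
Qed.

Lemma diff2_exact : range diff2 = ker diff1.
Proof.
apply/seteqP; split=> [_ [y _ <-]|y].
  rewrite /mkset; apply: (malg_ind (Q := fun y => diff1 (diff2 y) = 0)) => [|u v u0 v0|r c].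
  - by rewrite !linear0.
  - by rewrite !linearD u0 v0 addr0.
  rewrite [diff2 _]malg_liftU linearZ /=; have [_ r0] := rel_valP r.
  by rewrite -/diff1 diff1_omega ?(cst_ker r0) // r0 raddf0 scaler0.
rewrite /mkset => /diff1_ker[f [f0 <-]]; have [N EN] := hpart_sum d f.
have H j : exists r, rel_val r = hpart F d j f.
  have [||r [_ E]] := @relation_of j (hpart F d j f); last by exists r.
    by rewrite hpart_hpart eqxx.
  exact: hpart_ker.
have [r Hr] := choice H.
exists (\sum_(j < N) mkmalgU (r j) 1) => //.
rewrite linear_sum {1}EN omega_sum; apply: eq_bigr => j _.
by rewrite /diff2 /= malg_liftU scale1r Hr.
Qed.

(* From Tor_2 = I / (F_+ I + I F_+). *)
Lemma relations_decomposable j f : ~ tor_neq0 A 2 j -> (forall i, (d i < j)%N) ->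
  hpart F d j f = f -> phi f = 0 -> exists u v, [/\ XI u, IX v & f = u + v].
Proof.
move=> tor dj fj f0.
have c0 := cst_ker f0.
have w0 : diff1 (omega f) = 0 by rewrite diff1_omega // f0 raddf0.
(* Since [j] exceeds all degrees of generators, the coefficients of [omega f] have positive
   degree. *)
have Iw : irr_span setT (omega f).
  rewrite /omega; elim/big_rec: _ => [|i y _ Hy]; first exact: irr_span0.
  apply: irr_spanD Hy; rewrite -[phi _]mulr1 -scale_malgU; apply: irr_span_gen => //.
  rewrite -fj rder_hpart (ltnW (dj i)).
  by apply: (@irr_homogeneous (j - d i)); rewrite ?subn_gt0 //; apply: phi_hpart_deg.
have [N [a [y [Hay E]]]] := tor2_syzygy diff1_deg diff1_exact tor (omega_deg fj) w0 Iw.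
have [b Hb] := choice (fun l => phi_surj (a l)).
have [g Hg] := choice (fun l => diff1_ker (Hay l).2).
have b0 l : cst F (b l) = 0 by apply: cst_irr; rewrite Hb; have [] := Hay l.
(* [b l] in F_+ and [g l] in I lift [a l] and [y l]. So [u] is in F_+ I, and [omega] kills [f - u],
   which is therefore in I F_+. *)
pose u := \sum_(l < N) b l * g l.
have XIu : XI u.
  rewrite /u; elim/big_rec: _ => [|l z _]; last by apply: XID; apply: XI_mul => //; have [] := Hg l.
  by rewrite -[0](mulr0 (0 : F)); apply: XI_mul; rewrite linear0.
exists u, (f - u); split=> //; last by rewrite addrCA subrr addr0.
apply: omega_IX; first by rewrite linearB /= c0 (cst_ker (XI_ker XIu)) subrr.
rewrite omegaD omegaN E /u omega_sum -sumrB big1 // => l _; have [g0 gy] := Hg l.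
by rewrite omegaM ?(cst_ker g0) // gy Hb subrr.
Qed.

(* From Tor_3 = (F_+ I /\ I F_+) / (I I + F_+ I F_+). *)
Lemma overlaps_decomposable j z : ~ tor_neq0 A 3 j ->
  hpart F d j z = z -> XI z -> IX z -> overlap z.
Proof.
move=> tor zj [r r0 zE] IXz.
(* [s] is a set-theoretic section of [phi]. The normalization s 0 = 0 allows sums over supports to
   be extended to larger finite sets. *)
have [s0 Hs0] := choice phi_surj; pose s a := if a == 0 then 0 else s0 a.
have Hs a : phi (s a) = a by rewrite /s; case: eqP => [->|_] //; rewrite linear0.
pose Psi (D : {fset relation}) (y : malg relation A) : F :=
  \sum_(q <- D) s (mcoeff q y) * rel_val q.
have PsiEw (D : {fset relation}) y : (msupp y `<=` D)%fset -> Psi D y = Psi (msupp y) y.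
  move=> sD; symmetry; apply: big_fset_incl => // q _.
  by rewrite -mcoeff_eq0 => /eqP ->; rewrite /s eqxx mul0r.
have relker q : phi (rel_val q) = 0 by have [] := rel_valP q.
(* [psi] lifts the free module on the relations to F. It is additive and compatible with [phi] only
   modulo I I: the defects of [s] lie in I and are multiplied by relations. *)
pose psi y := Psi (msupp y) y.
have psiD y y' : overlap (psi (y + y') - (psi y + psi y')).
  pose D := (msupp (y + y') `|` (msupp y `|` msupp y'))%fset.
  rewrite /psi -(PsiEw D (y + y')) ?fsubsetUl //.
  rewrite -(PsiEw D y); last by rewrite /D fsetUCA fsubsetUl.
  rewrite -(PsiEw D y'); last by rewrite /D fsetUA fsubsetUr.
  rewrite /Psi -big_split -sumrB; apply: overlap_sum => q _.
  rewrite /= -mulrDl -mulrBl; apply: OverlapM => //.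
  by rewrite linearB linearD /= !Hs mcoeffD subrr.
have psiZ b y : overlap (psi (phi b *: y) - b * psi y).
  pose D := (msupp (phi b *: y) `|` msupp y)%fset.
  rewrite /psi -(PsiEw D (phi b *: y)) ?fsubsetUl // -(PsiEw D y) ?fsubsetUr //.
  rewrite /Psi mulr_sumr -sumrB; apply: overlap_sum => q _.
  rewrite mulrA -mulrBl; apply: OverlapM => //.
  by rewrite linearB /= phiM !Hs mcoeffZ subrr.
have psiU b q : overlap (psi (mkmalgU q (phi b)) - b * rel_val q).
  rewrite /psi -(PsiEw [fset q]%fset) ?msuppU_le //.
  rewrite /Psi big_seq_fset1 mcoeffUU -mulrBl; apply: OverlapM => //.
  by rewrite linearB /= Hs subrr.
have ovl_trans u v w : overlap (u - v) -> overlap (v - w) -> overlap (u - w).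
  by move=> H1 H2; rewrite -(subrK v u) -addrA; apply: OverlapD.
have psi_sum N (y : nat -> malg relation A) (g : nat -> F) :
    (forall l, (l < N)%N -> overlap (psi (y l) - g l)) ->
    overlap (psi (\sum_(l < N) y l) - \sum_(l < N) g l).
  elim: N => [|N IH] H.
    by rewrite !big_ord0 /psi /Psi msupp0 big_seq_fset0 subrr; apply: overlap0.
  rewrite !big_ord_recr /=; apply: ovl_trans (psiD _ _) _.
  rewrite opprD addrACA; apply: OverlapD; last by apply: H.
  by apply: IH => l lN; apply: H; apply: ltnW.
(* Replacing the cofactors by homogeneous parts of degree j - d_i turns them into basis elements
   [q i]. *)
pose r' i := if (d i <= j)%N then hpart F d (j - d i)%N (r i) else 0.
have zE' : z = \sum_i X F i * r' i.
  rewrite -zj zE linear_sum; apply: eq_bigr => i _; rewrite hpart_mulX /r'.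
  by case: ifP => _; rewrite ?mulr0.
have r'0 i : phi (r' i) = 0 by rewrite /r'; case: ifP => _; rewrite ?linear0 // hpart_ker.
have Hq i : exists q, rel_deg q = (j - d i)%N /\ rel_val q = r' i.
  apply: relation_of => //; rewrite /r'; case: ifP => _; last by rewrite linear0.
  by rewrite hpart_hpart eqxx.
have [q {}Hq] := choice Hq.
(* [zeta] lifts [z] to the free module on the relations. Its image under [diff2] is [omega z], which
   vanishes because [z] is in I F_+. *)
pose zeta : malg relation A := \sum_(i | (d i <= j)%N) mkmalgU (q i) (x i).
have zE2 : z = \sum_(i | (d i <= j)%N) X F i * r' i.
  rewrite {1}zE' [RHS]big_mkcond /=; apply: eq_bigr => i _; rewrite /r'.
  by case: ifP => _; rewrite ?mulr0.
have zeta_deg : hfree rel_deg j zeta.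
  apply: hfree_sum => i dj; apply: HFreeU (x_deg i) _; have [-> _] := Hq i; exact: subnKC.
have zeta_ker : diff2 zeta = 0.
  rewrite -(IX_omega IXz) {1}zE2 omega_sum /zeta linear_sum; apply: eq_bigr => i _.
  have [_ E] := Hq i; rewrite /diff2 /= malg_liftU E omegaM ?phiX //; exact: cst_ker.
have zeta_irr : irr_span setT zeta.
  rewrite /zeta; elim/big_rec: _ => [|i y _ Hy]; first exact: irr_span0.
  apply: irr_spanD Hy; rewrite -[x i]mulr1 -scale_malgU; apply: irr_span_gen => //.
  exact: irr_homogeneous (x_deg i).
(* Vanishing of Tor_3 rewrites [zeta] with coefficients in A_+ and elements [y l] of the kernel of
   [diff2], whose lifts by [psi] lie in I F_+. *)
have [N [a [y [Hay E]]]] :=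
  tor3_syzygy diff1_deg diff1_exact diff2_deg diff2_exact tor zeta_deg zeta_ker zeta_irr.
have psi_ker w : diff2 w = 0 -> IX (psi w).
  move=> w0; apply: omega_IX.
    by apply: cst_ker; rewrite linear_sum big1 // => p _; rewrite phiM relker mulr0.
  rewrite -w0 /psi /Psi omega_sum /diff2 /= /malg_lift; apply: eq_bigr => p _.
  by rewrite omegaM ?Hs //; exact: cst_ker.
have [b Hb] := choice (fun l => phi_surj (a l)).
have b0 l : cst F (b l) = 0 by apply: cst_irr; rewrite Hb; have [] := Hay l.
have ovl1 : overlap (psi zeta - \sum_(l < N) b l * psi (y l)).
  rewrite E; apply: (psi_sum N (fun l => a l *: y l) (fun l => b l * psi (y l))) => l _.
  by rewrite -Hb; apply: psiZ.
(* An element of F_+ times one of I F_+ is a sum of terms X_i f X_m with f in I. *)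
have ovl2 : overlap (\sum_(l < N) b l * psi (y l)).
  apply: overlap_sum => l _; have [_ /psi_ker[t t0 ->]] := Hay l.
  rewrite {1}(lder_decomp0 (b0 l)) mulr_suml; apply: overlap_sum => i _.
  rewrite mulr_sumr; apply: overlap_sum => m _.
  rewrite mulrA -[X F i * _ * _]mulrA; apply: OverlapX.
  by rewrite phiM t0 mulr0.
(* Modulo I I, [psi] sends the summand x_i of [zeta] to X_i r'_i. The families over ['I_n] become
   sequences so that [psi_sum] applies. *)
have ovl3 : overlap (psi zeta - z).
  rewrite {1}zE2 /zeta big_mkcond [X in _ - X]big_mkcond /=.
  pose e i := if (d i <= j)%N then mkmalgU (q i) (x i) else 0 : malg relation A.
  pose e' i := if (d i <= j)%N then X F i * r' i else 0.
  pose lft (T : zmodType) (h : 'I_n -> T) (l : nat) :=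
    if (insub l : option 'I_n) is Some i then h i else 0.
  have -> : \sum_i e i = \sum_(l < n) lft _ e l by apply: eq_bigr => i _; rewrite /lft valK.
  have -> : \sum_i e' i = \sum_(l < n) lft _ e' l by apply: eq_bigr => i _; rewrite /lft valK.
  apply: (psi_sum n (lft _ e) (lft _ e')) => l ln; rewrite /lft insubT /e /e' /=; case: ifP => _.
    by have [_ <-] := Hq (Ordinal ln); rewrite -phiX; apply: psiU.
  by rewrite /psi /Psi msupp0 big_seq_fset0 subrr; apply: overlap0.
have := OverlapD (OverlapD ovl1 ovl2) (overlapN ovl3).
by rewrite subrK opprB addrCA subrr addr0.
Qed.

End Presentation.

(** * Homogeneous generators from Tor_1 *)

Section Generators.
Variables (k : fieldType) (A : connGrAlg k).
Local Notation gA := (cga_grading A).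
Local Notation irr := (irrelevant_ideal A).

(** The ideal of A formed by the degrees from [j] on. *)
Definition tail (j : nat) : set A := hsum (fun i => @cga_comp k A (j + i)%N).

Lemma tail_irr : tail 1 = irr. Proof. by []. Qed.

Lemma tail0 j : tail j 0.
Proof. by apply: (@hsum0 _ (fun i => @cga_comp k A (j + i)%N)) => i; apply: gr0 gA _. Qed.

Lemma tailD j u v : tail j u -> tail j v -> tail j (u + v).
Proof.
apply: (@hsumD _ (fun i => @cga_comp k A (j + i)%N)) => [i|i y z]; first exact: gr0 gA _.
exact: grD gA _ _ _.
Qed.

Lemma tail_hom j i u : (j <= i)%N -> cga_comp i u -> tail j u.
Proof.
move=> ji Gu; apply: (@hsum_hom _ (fun i => @cga_comp k A (j + i)%N) _ (i - j)%N).
  by move=> l; apply: gr0 gA _.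
by rewrite subnKC.
Qed.

Lemma tail_ind j (Q : A -> Prop) : Q 0 -> (forall u v, Q u -> Q v -> Q (u + v)) ->
  (forall i u, (j <= i)%N -> cga_comp i u -> Q u) -> forall u, tail j u -> Q u.
Proof.
move=> Q0 QD Qh u [N [y [Gy ->]]]; elim/big_rec: _ => // i z _; apply: QD.
by apply: (Qh (j + i)%N); rewrite ?leq_addr.
Qed.

Lemma tailM p q u v : tail p u -> tail q v -> tail (p + q) (u * v).
Proof.
move=> tu tv; move: u tu; apply: tail_ind => [|u u' H H'|i u pi Gu].
- by rewrite mul0r; apply: tail0.
- by rewrite mulrDl; apply: tailD.
move: v tv; apply: tail_ind => [|v v' H H'|l v ql Gv].
- by rewrite mulr0; apply: tail0.
- by rewrite mulrDr; apply: tailD.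
by apply: (@tail_hom _ (i + l)%N); [apply: leq_add|apply: cga_mul].
Qed.

Lemma tail_component j p u : (j < p)%N -> tail p u -> component (@cga_comp k A) j u = 0.
Proof.
move=> jp tu; move: u tu; apply: tail_ind => [|v w v0 w0|i v pi Gv].
- by rewrite (component_hom gA (i := j)) ?eqxx //; apply: gr0 gA _.
- by rewrite (componentD gA) v0 w0 addr0.
by rewrite (component_hom gA (i := i)) // gtn_eqF // (leq_trans jp).
Qed.

Variables (n : nat) (F : freeAlgebra k n) (d : 'I_n -> nat) (x : 'I_n -> A).
Hypothesis x_deg : forall i, cga_comp (d i) (x i).
Local Notation phi := (phi F x).

(** Taking components of degree [j] discards [v], and [phi] is compatible with components. *)
Lemma range_phi_homogeneous j y : cga_comp j y ->
  (exists f v, tail j.+1 v /\ y = phi f + v) -> range phi y.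
Proof.
move=> Gy [f [v [tv E]]]; exists (hpart F d j f) => //.
have := component_hom gA j Gy; rewrite eqxx => <-.
by rewrite E (componentD gA) (tail_component (ltnSn j) tv) addr0 (phi_hpart x_deg).
Qed.

Lemma range_phiD u v : range phi u -> range phi v -> range phi (u + v).
Proof. by move=> [f _ <-] [g _ <-]; exists (f + g); rewrite ?linearD. Qed.

Lemma range_phiM u v : range phi u -> range phi v -> range phi (u * v).
Proof. by move=> [f _ <-] [g _ <-]; exists (f * g); rewrite ?phiM. Qed.

(** Tor_1 is A_+ / A_+ A_+. Above degree [a] a homogeneous element is thus a sum of products from
    A_+, where only factors of smaller degree matter, and these are in the range by induction. *)
Lemma phi_surjective a : (forall j, (a < j)%N -> ~ tor_neq0 A 1 j) ->
  (forall j y, (j <= a)%N -> cga_comp j y -> range phi y) -> forall y, exists f, phi f = y.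
Proof.
move=> tor low.
suff hom j : forall y, cga_comp j y -> range phi y.
  move=> y; have [N [z [Gz ->]]] := gr_span gA y.
  suff [f _ <-] : range phi (\sum_(i < N) z i) by exists f.
  elim/big_rec: _ => [|i u _]; first by exists 0; rewrite ?linear0.
  by apply: range_phiD; apply: hom (Gz i).
elim/ltn_ind: j => j IH y Gy; have [ja|aj] := leqP j a; first exact: low ja Gy.
have Iy : irr y by apply: (irr_homogeneous (leq_ltn_trans (leq0n a) aj)).
have hy : hfree (A := A) (fun _ : unit => 0%N) j (mkmalgU tt y) by apply: HFreeU Gy (addn0 _).
have ky : free_aug A (mkmalgU tt y) = 0 by apply/free_augU.
have sy : irr_span setT (mkmalgU tt y).
  by rewrite -[y]mulr1 -scale_malgU; apply: irr_span_gen.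
have [N [b [c [Hbc E]]]] := tor1_syzygy (tor _ aj) hy ky sy.
have cI l : irr (mcoeff tt (c l)).
  by have [_] := Hbc l; rewrite /mkset {1}(mkmalgU_unit (c l)) => /free_augU.
(* Components of degree below [j] are in the range by induction; the others form the tail. *)
have split b' : irr b' -> exists u v, [/\ range phi u, irr u, tail j v & b' = u + v].
  rewrite -tail_irr; move: b'; apply: tail_ind => [|b1 b2|i u i0 Gu].
  - by exists 0, 0; split; rewrite ?addr0 //; [exists 0; rewrite ?linear0|apply: irr0|apply: tail0].
  - move=> [u [v [ru Iu tv ->]]] [u' [v' [ru' Iu' tv' ->]]].
    exists (u + u'), (v + v'); split; last by rewrite addrACA.
    + exact: range_phiD.
    + exact: irrD.
    + exact: tailD.
  have [ij|ji] := ltnP i j.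
    exists u, 0; split; rewrite ?addr0 //; [exact: IH ij _ Gu|exact: (irr_homogeneous i0)|exact: tail0].
  exists 0, u; split; rewrite ?add0r //; [|exact: irr0|exact: tail_hom Gu].
  by exists 0; rewrite ?linear0.
apply: (range_phi_homogeneous Gy).
have -> : y = \sum_(l < N) b l * mcoeff tt (c l).
  have := congr1 (mcoeff tt) E; rewrite mcoeffUU raddf_sum => ->.
  by apply: eq_bigr => l _; rewrite /= mcoeffZ.
elim/big_rec: _ => [|l z _ [f [v [tv ->]]]].
  by exists 0, 0; rewrite linear0 addr0; split=> //; apply: tail0.
have [Ib _] := Hbc l; have [u [w [ru Iu tw Eb]]] := split _ Ib.
have [u' [w' [ru' Iu' tw' Ec]]] := split _ (cI l).
have [g _ Eg] := range_phiM ru ru'.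
(* A tail from degree [j] on times a factor from A_+ lies in degrees above [j], so only [g] matters
   modulo that tail. *)
exists (g + f), (u * w' + w * mcoeff tt (c l) + v); split.
  apply: tailD => //; apply: tailD.
    by rewrite -add1n; apply: tailM; rewrite ?tail_irr.
  by rewrite -addn1; apply: tailM; rewrite ?tail_irr.
rewrite linearD Eg Eb [in LHS]Ec mulrDl mulrDr -Ec -!addrA; congr (_ + _).
by rewrite [RHS]addrCA; congr (_ + _); rewrite [RHS]addrCA.
Qed.

End Generators.

(** The given generators reach all degrees up to [a], and the vanishing of Tor_1 above [a] takes
    care of the rest. *)
Lemma exists_generators (k : fieldType) (A : connGrAlg k) (n a : nat) (F : freeAlgebra k n) :
  (0 < a)%N -> at_most_generators A n -> (forall j, (a < j)%N -> ~ tor_neq0 A 1 j) ->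
  exists (d : 'I_n -> nat) (x : 'I_n -> A),
    [/\ forall i, (0 < d i <= a)%N, forall i, cga_comp (d i) (x i) &
        forall y, exists f, phi F x f = y].
Proof.
move=> a0 [s [ss homs gens]] tor.
(* Generators of degree 0 or above [a] are redundant and are replaced by 0, in degree 1. *)
have Hdx (i : 'I_n) : exists dx : nat * A, [/\ (0 < dx.1 <= a)%N, cga_comp dx.1 dx.2 &
    forall e, (0 < e <= a)%N -> cga_comp e (nth 0 s i) -> dx.2 = nth 0 s i].
  have [[e [ea Ge]]|no] := pselect (exists e, (0 < e <= a)%N /\ cga_comp e (nth 0 s i)).
    by exists (e, nth 0 s i).
  exists (1%N, 0); split=> //; first by apply: gr0 (cga_grading A) _.
  by move=> e ea Ge; case: no; exists e.
have [dx Hdx'] := choice Hdx; pose d i := (dx i).1; pose x i := (dx i).2.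
have xd i : cga_comp (d i) (x i) by have [] := Hdx' i.
exists d, x; split=> //; first by move=> i; have [] := Hdx' i.
apply: (phi_surjective xd tor) => j y ja Gy.
apply: (range_phi_homogeneous xd Gy).
(* The image of [phi] plus everything above degree [a] is a subalgebra that contains the given
   generators, hence is all of A. *)
pose S : {pred A} := [pred z | `[< exists f v, tail a.+1 v /\ z = phi F x f + v >]].
have Sphi f : phi F x f \in S.
  by rewrite inE; exists f, 0; split; [apply: tail0|rewrite addr0].
have Scl : GRing.subalg_closed S.
  split.
  - by have := Sphi 1; rewrite phi1.
  - move=> c u v; rewrite !inE => -[f [f' [tf ->]]] [g [g' [tg ->]]].
    exists (c *: f + g), (c *: f' + g'); split.
      apply: tailD => //; rewrite -[c *: _]mulr_algl -[a.+1]add0n; apply: tailM => //.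
      by apply: (@tail_hom _ _ _ 0%N) => //; rewrite cga_connected; exists c.
    by rewrite linearP /= scalerDr addrACA.
  - move=> u v; rewrite !inE => -[f [f' [tf ->]]] [g [g' [tg ->]]].
    exists (f * g), (phi F x f * g' + f' * (phi F x g + g')); split.
      have tall (z : A) : tail 0 z.
        have [N [w [Gw ->]]] := gr_span (cga_grading A) z.
        elim/big_rec: _ => [|i u' _]; first exact: tail0.
        by apply: tailD; apply: tail_hom (Gw i).
      by apply: tailD; [rewrite -[a.+1]add0n|rewrite -[a.+1]addn0]; apply: tailM.
    by rewrite phiM mulrDl mulrDr addrA.
have sS : {subset s <= S}.
  move=> z zs; have [e Ge] := homs _ zs.
  have [ae|ea] := ltnP a e.
    rewrite inE; exists 0, z; rewrite linear0 add0r; split=> //.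
    exact: tail_hom Ge.
  have [e0|e0] := posnP e.
    move: Ge; rewrite e0 cga_connected => -[c _ <-].
    by have := Sphi (c%:A); rewrite linearZ /= phi1.
  have il : (index z s < n)%N by apply: leq_trans ss; rewrite index_mem.
  have [_ _ /(_ e)] := Hdx' (Ordinal il); rewrite /= nth_index // e0 ea => /(_ isT Ge) E.
  by rewrite -E -[(dx _).2]/(x _) -(phiX F x).
have : y \in S by rewrite (gens S Scl sS).
rewrite inE => -[f [v [tv E]]].
exists f, v; split=> //; move: v tv {E}; apply: tail_ind => [|u v|i u ai Gu].
- exact: tail0.
- exact: tailD.
by apply: tail_hom Gu; apply: leq_trans ai; rewrite ltnS.
Qed.

(** * Row spaces of homogeneous components *)

Section Words.
Variables (n : nat) (d : 'I_n -> nat).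
Hypothesis d_gt0 : forall i, (0 < d i)%N.
Local Notation wt := (wt d).

(** A word of weight [j] in letters of positive weight has at most [j] letters, so it occurs among
    the bounded sequences. *)
Definition words (j : nat) : seq (seq 'I_n) :=
  [seq w <- [seq bseqval t | t <- enum {: j.-bseq 'I_n}] | wt w == j].

Definition nwords (j : nat) : nat := size (words j).
Local Notation N := nwords.

Definition word (j : nat) (t : 'I_(N j)) : seq 'I_n := nth [::] (words j) t.

Lemma words_uniq j : uniq (words j).
Proof. by rewrite filter_uniq // map_inj_uniq ?enum_uniq //; apply: val_inj. Qed.

Lemma mem_words j w : (w \in words j) = (wt w == j).
Proof.
rewrite mem_filter andb_idr // => /eqP wj.
have sw : (size w <= j)%N.
  rewrite -wj; elim: w {wj} => // i w IH; rewrite wt_cons /= -add1n.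
  exact: leq_add (d_gt0 i) IH.
by apply/mapP; exists (Bseq sw) => //; rewrite mem_enum.
Qed.

Lemma wt_word j (t : 'I_(N j)) : wt (word t) = j.
Proof. by apply/eqP; rewrite -mem_words mem_nth. Qed.

Lemma word_inj j : injective (@word j).
Proof. by move=> s t /eqP; rewrite nth_uniq ?words_uniq // => /eqP/val_inj. Qed.

Lemma word_onto j w : wt w = j -> exists t : 'I_(N j), word t = w.
Proof.
move=> /eqP; rewrite -mem_words => wj; have iw : (index w (words j) < N j)%N by rewrite index_mem.
by exists (Ordinal iw); rewrite /word nth_index.
Qed.

(** * Matrices of multiplication in the bases of words *)

Section Concatenation.
Variable R : comNzRingType.

Definition lcat_mx (w : seq 'I_n) p j : 'M[R]_(N p, N j) :=
  \matrix_(s, t) (w ++ word s == word t)%:R.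

Definition rcat_mx (w : seq 'I_n) p j : 'M[R]_(N p, N j) :=
  \matrix_(s, t) (word s ++ w == word t)%:R.

(** The matrix, acting on row vectors, of left multiplication by the element of weight [p] with
    coordinates [a]. *)
Definition conc p q j (a : 'rV[R]_(N p)) : 'M[R]_(N q, N j) :=
  \sum_s a 0 s *: lcat_mx (word s) q j.

Lemma conc_sum p q j (I : Type) (r : seq I) (P : pred I) (c : I -> R) (a : I -> 'rV[R]_(N p)) :
  conc q j (\sum_(i <- r | P i) c i *: a i) = \sum_(i <- r | P i) c i *: conc q j (a i).
Proof.
rewrite /conc; under eq_bigr do rewrite summxE scaler_suml.
rewrite exchange_big; apply: eq_bigr => i _; rewrite scaler_sumr.
by apply: eq_bigr => s _; rewrite mxE scalerA.
Qed.

(** Prefixing a fixed word is injective, so the rows are distinct unit vectors. *)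
Lemma lcat_mxK w p j : (wt w + p = j)%N -> lcat_mx w p j *m (lcat_mx w p j)^T = 1%:M.
Proof.
move=> wp; apply/matrixP => s s'; rewrite !mxE.
have [t tE] : exists t : 'I_(N j), word t = w ++ word s.
  by apply: word_onto; rewrite wt_cat wt_word.
rewrite (bigD1 t) //= !mxE tE eqxx mul1r big1 ?addr0 => [|t' t't].
  by rewrite eqseq_cat // eqxx /= (inj_eq (@word_inj _)) eq_sym.
rewrite !mxE; case: eqP => [E|_]; last by rewrite mul0r.
by case/eqP: t't; apply: word_inj; rewrite tE.
Qed.

Lemma rcat_mxK w p j : (p + wt w = j)%N -> rcat_mx w p j *m (rcat_mx w p j)^T = 1%:M.
Proof.
move=> wp; apply/matrixP => s s'; rewrite !mxE.
have [t tE] : exists t : 'I_(N j), word t = word s ++ w.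
  by apply: word_onto; rewrite wt_cat wt_word.
rewrite (bigD1 t) //= !mxE tE eqxx mul1r big1 ?addr0 => [|t' t't].
  rewrite -(inj_eq (can_inj revK)) !rev_cat eqseq_cat // eqxx (inj_eq (can_inj revK)).
  by rewrite (inj_eq (@word_inj _)) eq_sym.
rewrite !mxE; case: eqP => [E|_]; last by rewrite mul0r.
by case/eqP: t't; apply: word_inj; rewrite tE.
Qed.

Lemma lcat_mx_orth i i' p p' j : i != i' ->
  lcat_mx [:: i] p j *m (lcat_mx [:: i'] p' j)^T = 0.
Proof.
move=> ii'; apply/matrixP => s s'; rewrite !mxE big1 // => t _; rewrite !mxE.
case: eqP => [<-|_]; last by rewrite mul0r.
by rewrite /= eqseq_cons eq_sym (negPf ii') mulr0.
Qed.

Lemma rcat_mx_orth i i' p p' j : i != i' ->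
  rcat_mx [:: i] p j *m (rcat_mx [:: i'] p' j)^T = 0.
Proof.
move=> ii'; apply/matrixP => s s'; rewrite !mxE big1 // => t _; rewrite !mxE.
case: eqP => [<-|_]; last by rewrite mul0r.
by rewrite !cats1 eqseq_rcons [X in _ && X]eq_sym (negPf ii') andbF mulr0.
Qed.

End Concatenation.

Lemma map_lcat_mx (R S : comNzRingType) (f : {rmorphism R -> S}) w p j :
  map_mx f (lcat_mx R w p j) = lcat_mx S w p j.
Proof. by apply/matrixP => s t; rewrite !mxE rmorph_nat. Qed.

Lemma map_rcat_mx (R S : comNzRingType) (f : {rmorphism R -> S}) w p j :
  map_mx f (rcat_mx R w p j) = rcat_mx S w p j.
Proof. by apply/matrixP => s t; rewrite !mxE rmorph_nat. Qed.

Lemma map_conc (R S : comNzRingType) (f : {rmorphism R -> S}) p q j (a : 'rV[R]_(N p)) :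
  map_mx f (conc q j a) = conc q j (map_mx f a).
Proof.
rewrite /conc map_mx_sum; apply: eq_bigr => s _.
by rewrite map_mxZ map_lcat_mx mxE.
Qed.

(** * Components of ideals as row spaces *)

Section Spaces.
Variable k : fieldType.

(** The span of all products of an element of [B] and one of [C]. The rows of [B] suffice because
    [conc] is linear in the left factor. *)
Definition prodmx m1 m2 p q j (B : 'M[k]_(m1, N p)) (C : 'M[k]_(m2, N q)) : 'M[k]_(N j) :=
  (\sum_s <<C *m conc q j (row s B)>>)%MS.

Lemma prodmx_sub m1 m2 p q j (B : 'M[k]_(m1, N p)) (C : 'M[k]_(m2, N q))
    (a : 'rV_(N p)) (c : 'rV_(N q)) :
  (a <= B)%MS -> (c <= C)%MS -> (c *m conc q j a <= prodmx j B C)%MS.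
Proof.
move=> /submxP[u ->] cC; rewrite (mulmx_sum_row u) conc_sum mulmx_sumr.
apply: summx_sub => s _; rewrite -scalemxAr; apply: scalemx_sub.
by apply: (sumsmx_sup s) => //; rewrite genmxE submxMr.
Qed.

Lemma prodmx_subP m1 m2 m3 p q j (B : 'M[k]_(m1, N p)) (C : 'M[k]_(m2, N q))
    (E : 'M[k]_(m3, N j)) :
  (forall a c : 'rV_(_), (a <= B)%MS -> (c <= C)%MS -> (c *m conc q j a <= E)%MS) ->
  (prodmx j B C <= E)%MS.
Proof.
move=> H; apply/sumsmx_subP => s _; rewrite genmxE; apply/row_subP => t.
by rewrite row_mul; apply: H; apply: row_sub.
Qed.

Lemma prodmx_eqmx m1 m2 m1' m2' p q j (B : 'M[k]_(m1, N p)) (C : 'M[k]_(m2, N q))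
    (B' : 'M[k]_(m1', N p)) (C' : 'M[k]_(m2', N q)) :
  (B :=: B')%MS -> (C :=: C')%MS -> (prodmx j B C :=: prodmx j B' C')%MS.
Proof.
move=> BB' CC'; apply/eqmxP/andP; split; apply: prodmx_subP => a c.
  by rewrite BB' CC'; apply: prodmx_sub.
by rewrite -BB' -CC'; apply: prodmx_sub.
Qed.

Variable U : forall j, 'M[k]_(N j).

(** If [U j] spans I_j, then [XI_mx], [IX_mx] and [overlap_mx] span the components of degree [j] of
    F_+ I, I F_+ and I I + F_+ I F_+. *)
Definition XI_mx j : 'M[k]_(N j) :=
  (\sum_(i | (d i <= j)%N) <<U (j - d i)%N *m lcat_mx k [:: i] (j - d i)%N j>>)%MS.

Definition IX_mx j : 'M[k]_(N j) :=
  (\sum_(i | (d i <= j)%N) <<U (j - d i)%N *m rcat_mx k [:: i] (j - d i)%N j>>)%MS.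

Definition overlap_mx j : 'M[k]_(N j) :=
  ((\sum_(p < j.+1) prodmx j (U p) (U (j - p)%N)) +
   \sum_(i | (d i <= j)%N) \sum_(i' | (d i' <= j - d i)%N)
     <<U (j - d i - d i')%N *m lcat_mx k [:: i'] (j - d i - d i')%N (j - d i)%N
       *m rcat_mx k [:: i] (j - d i)%N j>>)%MS.

(** Multiplying by the transpose of [L i] kills the other terms and recovers the term [B i]. So the
    sum is direct and each term keeps its rank. *)
Lemma rank_sum_orth (I : finType) (P : pred I) m (r : I -> nat)
    (B : forall i, 'M[k]_(r i)) (L : forall i, 'M[k]_(r i, m)) :
  (forall i, P i -> L i *m (L i)^T = 1%:M) ->
  (forall i i', i != i' -> L i *m (L i')^T = 0) ->
  \rank (\sum_(i | P i) <<B i *m L i>>)%MS = (\sum_(i | P i) \rank (B i))%N.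
Proof.
move=> L1 L0.
have dx : mxdirect (\sum_(i | P i) <<B i *m L i>>)%MS.
  apply/mxdirect_sumsP => i Pi; apply/eqP; rewrite -submx0; apply/rV_subP => v.
  rewrite sub_capmx => /andP[]; rewrite genmxE => /submxP[u ->] /sub_sumsmxP[w E].
  have : u *m (B i *m L i) *m (L i)^T = 0.
    rewrite E mulmx_suml big1 // => i' /andP[_ i'i].
    have /submxP[z ->] : (w i' *m <<B i' *m L i'>> <= B i' *m L i')%MS.
      by apply: submx_trans (submxMl _ _) _; rewrite genmxE.
    by rewrite -!mulmxA L0 // !mulmx0.
  rewrite -!mulmxA L1 // mulmx1 => uB; rewrite mulmxA uB mul0mx; exact: sub0mx.
rewrite (mxdirectP dx) /=; apply: eq_bigr => i Pi; rewrite mxrank_gen mxrankMfree //.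
by apply/row_freeP; exists (L i)^T; apply: L1.
Qed.

Lemma rank_XI_mx j : \rank (XI_mx j) = (\sum_(i | (d i <= j)%N) \rank (U (j - d i)%N))%N.
Proof.
apply: rank_sum_orth => [i dj|i i' ii']; last exact: lcat_mx_orth.
by apply: lcat_mxK; rewrite /wt big_seq1 subnKC.
Qed.

Lemma rank_IX_mx j : \rank (IX_mx j) = (\sum_(i | (d i <= j)%N) \rank (U (j - d i)%N))%N.
Proof.
apply: rank_sum_orth => [i dj|i i' ii']; last exact: rcat_mx_orth.
by apply: rcat_mxK; rewrite /wt big_seq1 subnK.
Qed.

(** Govorov's formulas in the degrees above [b], for Tor_2 and Tor_3 vanishing there. *)
Definition presents (b : nat) : Prop := forall j, (b < j)%N ->
  (U j :=: XI_mx j + IX_mx j)%MS /\ (XI_mx j :&: IX_mx j :=: overlap_mx j)%MS.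

(** F_+ I and I F_+ are both direct sums of shifted copies of I, one for each generator; hence the
    doubled sum. The overlap stands on the left to avoid subtraction. *)
Lemma rank_presents b j : presents b -> (b < j)%N ->
  (\rank (U j) + \rank (overlap_mx j) = (\sum_(i | (d i <= j)%N) \rank (U (j - d i))).*2)%N.
Proof.
move=> pU bj; have [E1 E2] := pU j bj.
by rewrite E1 -E2 mxrank_sum_cap rank_XI_mx rank_IX_mx addnn.
Qed.

End Spaces.
End Words.

(** * Coordinates of elements of the free algebra *)

Section Coordinates.
Variables (k : fieldType) (n : nat) (F : freeAlgebra k n) (d : 'I_n -> nat).
Hypothesis d_gt0 : forall i, (0 < d i)%N.
Implicit Types f g : F.
Local Notation N := (nwords d).
Local Notation wt := (wt d).

Definition vec j : {linear F -> 'rV[k]_(N j)} :=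
  fa_lin F (fun w => \row_t (w == word t)%:R).

Definition unvec j (v : 'rV[k]_(N j)) : F := \sum_t v 0 t *: fa_wd F (word t).

Lemma unvecD j : {morph @unvec j : u v / u + v}.
Proof.
by move=> u v; rewrite /unvec -big_split; apply: eq_bigr => t _; rewrite mxE scalerDl.
Qed.

Lemma unvecZ j c (v : 'rV_(N j)) : unvec (c *: v) = c *: unvec v.
Proof. by rewrite /unvec scaler_sumr; apply: eq_bigr => t _; rewrite mxE scalerA. Qed.

Lemma unvec0 j : unvec (0 : 'rV_(N j)) = 0.
Proof. by rewrite /unvec big1 // => t _; rewrite mxE scale0r. Qed.

Lemma unvecK j (v : 'rV_(N j)) : vec j (unvec v) = v.
Proof.
apply/rowP => t; rewrite /unvec linear_sum summxE (bigD1 t) //= linearZ /= lin_wd !mxE eqxx mulr1.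
rewrite big1 ?addr0 // => s st; rewrite linearZ /= lin_wd !mxE.
by rewrite (inj_eq (@word_inj _ _ _)) (negPf st) mulr0.
Qed.

Lemma vecK j f : unvec (vec j f) = hpart F d j f.
Proof.
elim/free_ind: f => [|f g IHf IHg|c w]; first by rewrite !linear0 unvec0.
  by rewrite !linearD unvecD IHf IHg.
rewrite !linearZ /= unvecZ !lin_wd; congr (_ *: _); rewrite /unvec.
case: eqP => [wj|wj].
  have [t tw] := word_onto d_gt0 wj; rewrite (bigD1 t) //= mxE tw eqxx scale1r big1 ?addr0 // => s st.
  by rewrite mxE -tw (inj_eq (@word_inj _ _ _)) eq_sym (negPf st) scale0r.
rewrite big1 // => t _; rewrite mxE; case: eqP => [E|_]; last by rewrite scale0r.
by case: wj; rewrite E (wt_word d_gt0).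
Qed.

Lemma vec_hpart j f : vec j (hpart F d j f) = vec j f.
Proof. by rewrite -vecK unvecK. Qed.

Lemma hpart_unvec j (v : 'rV_(N j)) : hpart F d j (unvec v) = unvec v.
Proof. by rewrite -vecK unvecK. Qed.

Lemma vec_wdM w j f : vec j (fa_wd F w * f) =
  if (wt w <= j)%N then vec (j - wt w)%N f *m lcat_mx d k w (j - wt w) j else 0.
Proof.
elim/free_ind: f => [|f g IHf IHg|c u].
- by rewrite mulr0 !linear0 mul0mx if_same.
- by rewrite mulrDr !linearD IHf IHg mulmxDl; case: ifP; rewrite ?addr0.
rewrite -scalerAr wdM !linearZ /= !lin_wd -scalemxAl.
case: leqP => [wj|wj]; last first.
  rewrite [X in _ *: X](_ : _ = 0) ?scaler0 //; apply/rowP => t; rewrite !mxE.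
  by case: eqP => // E; rewrite -(wt_word d_gt0 t) -E wt_cat ltnNge leq_addr in wj.
congr (_ *: _); apply/rowP => t; rewrite !mxE.
have [uj|uj] := eqVneq (wt u) (j - wt w)%N.
  have [s su] := word_onto d_gt0 uj; rewrite (bigD1 s) //= !mxE su eqxx mul1r big1 ?addr0 // => s' s's.
  by rewrite !mxE -su (inj_eq (@word_inj _ _ _)) eq_sym (negPf s's) mul0r.
rewrite big1 => [|s _]; last first.
  rewrite !mxE; case: eqP => [E|_]; last by rewrite mul0r.
  by rewrite E (wt_word d_gt0) eqxx in uj.
by case: eqP => // E; case/eqP: uj; rewrite -(wt_word d_gt0 t) -E wt_cat addKn.
Qed.

Lemma vec_Mwd w j f : vec j (f * fa_wd F w) =
  if (wt w <= j)%N then vec (j - wt w)%N f *m rcat_mx d k w (j - wt w) j else 0.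
Proof.
elim/free_ind: f => [|f g IHf IHg|c u].
- by rewrite mul0r !linear0 mul0mx if_same.
- by rewrite mulrDl !linearD IHf IHg mulmxDl; case: ifP; rewrite ?addr0.
rewrite -scalerAl wdM !linearZ /= !lin_wd -scalemxAl.
case: leqP => [wj|wj]; last first.
  rewrite [X in _ *: X](_ : _ = 0) ?scaler0 //; apply/rowP => t; rewrite !mxE.
  by case: eqP => // E; rewrite -(wt_word d_gt0 t) -E wt_cat ltnNge leq_addl in wj.
congr (_ *: _); apply/rowP => t; rewrite !mxE.
have [uj|uj] := eqVneq (wt u) (j - wt w)%N.
  have [s su] := word_onto d_gt0 uj; rewrite (bigD1 s) //= !mxE su eqxx mul1r big1 ?addr0 // => s' s's.
  by rewrite !mxE -su (inj_eq (@word_inj _ _ _)) eq_sym (negPf s's) mul0r.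
rewrite big1 => [|s _]; last first.
  rewrite !mxE; case: eqP => [E|_]; last by rewrite mul0r.
  by rewrite E (wt_word d_gt0) eqxx in uj.
by case: eqP => // E; case/eqP: uj; rewrite -(wt_word d_gt0 t) -E wt_cat addnK.
Qed.

Lemma wt1 i : wt [:: i] = d i.
Proof. by rewrite /wt big_seq1. Qed.

Lemma vec_XM i j f : vec j (X F i * f) =
  if (d i <= j)%N then vec (j - d i)%N f *m lcat_mx d k [:: i] (j - d i) j else 0.
Proof. by rewrite vec_wdM wt1. Qed.

Lemma vec_MX i j f : vec j (f * X F i) =
  if (d i <= j)%N then vec (j - d i)%N f *m rcat_mx d k [:: i] (j - d i) j else 0.
Proof. by rewrite vec_Mwd wt1. Qed.

Lemma vec_unvecM p j (a : 'rV_(N p)) f : vec j (unvec a * f) =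
  if (p <= j)%N then vec (j - p)%N f *m conc (j - p) j a else 0.
Proof.
rewrite /unvec mulr_suml linear_sum /conc mulmx_sumr.
under eq_bigr do rewrite -scalerAl linearZ /= vec_wdM (wt_word d_gt0).
case: ifP => _; last by rewrite big1 // => t _; rewrite scaler0.
by apply: eq_bigr => t _; rewrite -scalemxAr.
Qed.

End Coordinates.

(** * Subspaces as row spaces, and uniqueness of dimension *)

(** Take a matrix of maximal rank with rows in [U]; a further vector of [U] would increase the
    rank. *)
Lemma subspace_mx (k : fieldType) m (U : set 'rV[k]_m) : U 0 ->
  (forall c u v, U u -> U v -> U (c *: u + v)) ->
  exists M : 'M[k]_m, forall v, (v <= M)%MS <-> U v.
Proof.
move=> U0 UL.
pose ok r := `[< exists M : 'M[k]_m, (forall v : 'rV_m, (v <= M)%MS -> U v) /\ \rank M = r >].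
have ex : exists r, ok r.
  exists 0%N; apply/asboolP; exists 0; rewrite mxrank0; split=> // v.
  by rewrite submx0 => /eqP ->.
have bd r : ok r -> (r <= m)%N by move=> /asboolP[M [_ <-]]; apply: rank_leq_col.
case: (ex_maxnP ex bd) => r /asboolP[M [MU Mr]] max; exists M => v; split; first exact: MU.
move=> Uv; apply: contrapT => /negP nv.
have : (\rank (M + v)%MS <= \rank M)%N.
  rewrite Mr; apply: max; apply/asboolP; exists (M + v)%MS; split=> // w.
  case/sub_addsmxP => -[u1 u2] /= ->; rewrite addrC.
  have -> : u2 *m v = u2 0 0 *: v by rewrite {1}[u2]mx11_scalar mul_scalar_mx.
  by apply: UL => //; apply: MU; apply: submxMl.
rewrite (geq_leqif (mxrank_leqif_sup (addsmxSl M v))) => sub.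
by case/negP: nv; apply: submx_trans sub; apply: addsmxSr.
Qed.

(** The coordinates of the first basis in the second form a matrix with independent rows. *)
Lemma has_dim_le (k : fieldType) (V : lmodType k) (U : set V) p q :
  has_dim U p -> has_dim U q -> (p <= q)%N.
Proof.
move=> [e [free UE]] [e' [_ UE']].
have He i : exists c : 'I_q -> k, e i = \sum_l c l *: e' l.
  have : U (e i).
    rewrite UE; exists (fun l => (l == i)%:R) => //; rewrite (bigD1 i) //= eqxx scale1r.
    by rewrite big1 ?addr0 // => l li; rewrite (negPf li) scale0r.
  by rewrite UE' => -[c _ <-]; exists c.
have [c Hc] := choice He; pose M := \matrix_(i, l) c i l.
suff /eqP <- : row_free M by apply: rank_leq_col.
apply: inj_row_free => v vM; apply/rowP => i; rewrite mxE.
apply: (free (fun i => v 0 i)).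
under eq_bigr do rewrite Hc scaler_sumr.
rewrite exchange_big big1 //= => l _; under eq_bigr do rewrite scalerA.
rewrite -scaler_suml; have := congr1 (fun w : 'rV_q => w 0 l) vM; rewrite !mxE => E.
by rewrite [X in X *: _](_ : _ = 0) ?scale0r // -[RHS]E; apply: eq_bigr => t _; rewrite mxE.
Qed.

(** * The matrix form of a presentation *)

Section MatrixPresentation.
Variables (k : fieldType) (A : connGrAlg k) (n : nat) (F : freeAlgebra k n).
Variables (d : 'I_n -> nat) (x : 'I_n -> A).
Hypothesis d_gt0 : forall i, (0 < d i)%N.
Hypothesis x_deg : forall i, cga_comp (d i) (x i).
Hypothesis phi_surj : forall a, exists f, phi F x f = a.
Implicit Types f g : F.
Local Notation N := (nwords d).
Local Notation phi := (phi F x).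
Local Notation vec := (vec F d).
Local Notation unvec := (unvec F (d := d)).

Lemma relation_mx : exists U : forall j, 'M[k]_(N j),
  forall j (v : 'rV_(N j)), (v <= U j)%MS <-> phi (unvec v) = 0.
Proof.
suff H j : exists U : 'M[k]_(N j), forall v : 'rV_(N j), (v <= U)%MS <-> phi (unvec v) = 0.
  by exists (fun j => sval (cid (H j))) => j; apply: svalP (cid (H j)).
apply: (@subspace_mx _ _ [set v | phi (unvec v) = 0]); first by rewrite /= unvec0 linear0.
by move=> c u v /= u0 v0; rewrite unvecD unvecZ linearD linearZ /= u0 v0 scaler0 addr0.
Qed.

Variable U : forall j, 'M[k]_(N j).
Hypothesis UP : forall j (v : 'rV_(N j)), (v <= U j)%MS <-> phi (unvec v) = 0.

(** [phi] maps a complement of I_j in F_j isomorphically onto A_j, so a basis of the complement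
    gives one of A_j. *)
Lemma hilbert_series_rank j : hilbert_series A j = (N j - \rank (U j))%N.
Proof.
have dimE : has_dim (@cga_comp k A j) (N j - \rank (U j)).
  rewrite -mxrank_compl; pose C := row_base (U j)^C%MS.
  have EC (c : 'I_(\rank (U j)^C%MS) -> k) :
      \sum_t c t *: phi (unvec (row t C)) = phi (unvec ((\row_t c t) *m C)).
    rewrite mulmx_sum_row; elim/big_rec2: _ => [|t y1 y2 _ ->]; first by rewrite unvec0 linear0.
    by rewrite unvecD unvecZ linearD linearZ /= mxE.
  exists (fun t => phi (unvec (row t C))); split=> [c|].
    rewrite EC => /UP cU t.
    have : ((\row_t c t) *m C <= U j :&: (U j)^C)%MS.
      by rewrite sub_capmx cU (submx_trans (submxMl _ _)) // eq_row_base.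
    rewrite capmx_compl submx0 mulmx_free_eq0 ?row_base_free // => /eqP/rowP/(_ t).
    by rewrite !mxE.
  apply/seteqP; split=> [y Gy|_ [c _ <-]].
    have [f Ef] := phi_surj y.
    have Ey : y = phi (unvec (vec j f)).
      rewrite vecK // (phi_hpart x_deg) Ef.
      by rewrite (component_hom (cga_grading A) (i := j)) ?eqxx.
    have : (vec j f <= U j + (U j)^C)%MS by rewrite submx_full ?addsmx_compl_full.
    case/sub_addsmxP => -[u1 u2] /= E.
    have : (u2 *m (U j)^C <= C)%MS by rewrite eq_row_base submxMl.
    case/submxP => c Ec; exists (fun t => c 0 t) => //.
    rewrite EC Ey E unvecD linearD /= (UP (u1 *m U j)).1 ?submxMl // add0r Ec.
    by congr (phi (unvec (_ *m _))); apply/rowP => t; rewrite mxE.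
  apply: (gr_sum (cga_grading A)) => t _; apply: cga_scale.
  by rewrite -hpart_unvec //; apply: phi_hpart_deg.
rewrite /hilbert_series; case: xgetP => [m _ dm|/(_ _ dimE)] //.
by apply/eqP; rewrite eqn_leq !(has_dim_le dm, has_dim_le dimE).
Qed.

Lemma vec_ker j f : phi f = 0 -> (vec j f <= U j)%MS.
Proof. by move=> f0; apply/UP; rewrite vecK //; apply: hpart_ker. Qed.

Lemma XI_mxP j (v : 'rV_(N j)) : (v <= XI_mx U j)%MS <-> exists2 f, XI x f & v = vec j f.
Proof.
split=> [/sub_sumsmxP[u ->]|[f [r r0 ->] ->]].
  have H i : exists r, phi r = 0 /\ ((d i <= j)%N -> u i *m
      <<U (j - d i)%N *m lcat_mx d k [:: i] (j - d i) j>>%MS = vec j (X F i * r)).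
    have [dj|_] := boolP (d i <= j)%N; last by exists 0; rewrite linear0.
    have /submxP[w ->] : (u i *m <<U (j - d i)%N *m lcat_mx d k [:: i] (j - d i) j>> <=
        U (j - d i)%N *m lcat_mx d k [:: i] (j - d i) j)%MS.
      by apply: submx_trans (submxMl _ _) _; rewrite genmxE.
    exists (unvec (w *m U (j - d i)%N)); split; first by apply/UP/submxMl.
    by rewrite vec_XM // dj unvecK mulmxA.
  have [r Hr] := choice H.
  exists (\sum_(i | (d i <= j)%N) X F i * r i).
    exists (fun i => if (d i <= j)%N then r i else 0).
      by move=> i; case: ifP => _; [have [] := Hr i|rewrite linear0].
    by rewrite big_mkcond; apply: eq_bigr => i _; case: ifP; rewrite ?mulr0.
  by rewrite linear_sum; apply: eq_bigr => i dj; have [_ ->] := Hr i.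
rewrite linear_sum; apply: summx_sub => i _; rewrite vec_XM //.
case: ifP => dj; last exact: sub0mx.
by apply: (sumsmx_sup i) => //; rewrite genmxE submxMr // vec_ker.
Qed.

Lemma IX_mxP j (v : 'rV_(N j)) : (v <= IX_mx U j)%MS <-> exists2 f, IX x f & v = vec j f.
Proof.
split=> [/sub_sumsmxP[u ->]|[f [r r0 ->] ->]].
  have H i : exists r, phi r = 0 /\ ((d i <= j)%N -> u i *m
      <<U (j - d i)%N *m rcat_mx d k [:: i] (j - d i) j>>%MS = vec j (r * X F i)).
    have [dj|_] := boolP (d i <= j)%N; last by exists 0; rewrite linear0.
    have /submxP[w ->] : (u i *m <<U (j - d i)%N *m rcat_mx d k [:: i] (j - d i) j>> <=
        U (j - d i)%N *m rcat_mx d k [:: i] (j - d i) j)%MS.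
      by apply: submx_trans (submxMl _ _) _; rewrite genmxE.
    exists (unvec (w *m U (j - d i)%N)); split; first by apply/UP/submxMl.
    by rewrite vec_MX // dj unvecK mulmxA.
  have [r Hr] := choice H.
  exists (\sum_(i | (d i <= j)%N) r i * X F i).
    exists (fun i => if (d i <= j)%N then r i else 0).
      by move=> i; case: ifP => _; [have [] := Hr i|rewrite linear0].
    by rewrite big_mkcond; apply: eq_bigr => i _; case: ifP; rewrite ?mul0r.
  by rewrite linear_sum; apply: eq_bigr => i dj; have [_ ->] := Hr i.
rewrite linear_sum; apply: summx_sub => i _; rewrite vec_MX //.
case: ifP => dj; last exact: sub0mx.
by apply: (sumsmx_sup i) => //; rewrite genmxE submxMr // vec_ker.
Qed.

Lemma vec_overlap j f : overlap x f -> (vec j f <= overlap_mx U j)%MS.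
Proof.
elim=> [u v _ Hu _ Hv|u v u0 v0|i i' r r0].
- by rewrite linearD; apply: addmx_sub.
(* Split the left factor into homogeneous parts, which are again in I; each meets only the part of
   [v] of complementary degree. *)
- have [M EM] := hpart_sum d u; rewrite {1}EM mulr_suml linear_sum.
  apply: summx_sub => p _; rewrite -vecK // vec_unvecM //.
  case: ifP => pj; last exact: sub0mx.
  apply: submx_trans (addsmxSl _ _).
  have pj1 : (p < j.+1)%N by rewrite ltnS.
  by apply: (sumsmx_sup (Ordinal pj1)) => //=; apply: prodmx_sub; apply: vec_ker.
rewrite vec_MX //; case: ifP => di'; last exact: sub0mx.
rewrite vec_XM //; case: ifP => di; last by rewrite mul0mx; exact: sub0mx.
apply: submx_trans (addsmxSr _ _).
apply: (sumsmx_sup i') => //; apply: (sumsmx_sup i) => //.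
by rewrite genmxE !submxMr // vec_ker.
Qed.

Lemma overlap_mxP j (v : 'rV_(N j)) : (v <= overlap_mx U j)%MS <->
  exists2 f, overlap x f & v = vec j f.
Proof.
split=> [|[f of_ ->]]; last exact: vec_overlap.
pose W := [set v | exists2 f, overlap x f & v = vec j f].
have W0 : W 0 by exists 0; [apply: overlap0|rewrite linear0].
have WD u w : W u -> W w -> W (u + w).
  by move=> [f Of ->] [g Og ->]; exists (f + g); [apply: OverlapD|rewrite linearD].
case/sub_addsmxP => -[u1 u2] /= ->; apply: (WD).
  have : (u1 *m (\sum_(p < j.+1) prodmx j (U p) (U (j - p)%N))%MS <=
      \sum_(p < j.+1) prodmx j (U p) (U (j - p)%N))%MS by apply: submxMl.
  case/sub_sumsmxP => w ->; elim/big_rec: _ => // p u _; apply: (WD).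
  have /sub_sumsmxP[z ->] : (w p *m prodmx j (U p) (U (j - p)%N) <= prodmx j (U p) (U (j - p)%N))%MS.
    exact: submxMl.
  elim/big_rec: _ => // s {}u _; apply: (WD).
  have : (z s *m <<U (j - p)%N *m conc (j - p) j (row s (U p))>> <=
      U (j - p)%N *m conc (j - p) j (row s (U p)))%MS.
    by apply: submx_trans (submxMl _ _) _; rewrite genmxE.
  case/submxP => c ->; exists (unvec (row s (U p)) * unvec (c *m U (j - p)%N)).
    by apply: OverlapM; apply/UP; [apply: row_sub|apply: submxMl].
  by rewrite vec_unvecM // -ltnS ltn_ord unvecK mulmxA.
set B := (\sum_(i | _) _)%MS; have : (u2 *m B <= B)%MS by apply: submxMl.
case/sub_sumsmxP => w ->; elim/big_rec: _ => // i u di; apply: (WD).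
set B' := (\sum_(i' | _) _)%MS; have : (w i *m B' <= B')%MS by apply: submxMl.
case/sub_sumsmxP => z ->; elim/big_rec: _ => // i' {}u di'; apply: (WD).
set B'' := (U _ *m _ *m _); have : (z i' *m <<B''>> <= B'')%MS.
  by apply: submx_trans (submxMl _ _) _; rewrite genmxE.
case/submxP => c ->; exists (X F i' * unvec (c *m U (j - d i - d i')%N) * X F i).
  by apply: OverlapX; apply/UP; apply: submxMl.
by rewrite vec_MX // di vec_XM // di' unvecK /B'' !mulmxA.
Qed.

(** As [b] also bounds the degrees of the generators, every degree above it satisfies the hypothesis
    of [relations_decomposable]. *)
Lemma tor_presents b : (forall i, (d i <= b)%N) ->
  (forall j, (b < j)%N -> ~ tor_neq0 A 2 j) -> (forall j, (b < j)%N -> ~ tor_neq0 A 3 j) ->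
  presents U b.
Proof.
move=> db tor2 tor3 j bj; split; apply/eqmxP/andP; split; apply/rV_subP => v.
- move=> /UP v0; have dj i : (d i < j)%N by apply: leq_ltn_trans bj.
  have [u [w [Xu Xw E]]] := relations_decomposable d_gt0 x_deg phi_surj (tor2 _ bj) dj (hpart_unvec F d_gt0 v) v0.
  rewrite -[v](unvecK F) E linearD; apply: addmx_sub_adds.
    by apply/XI_mxP; exists u.
  by apply/IX_mxP; exists w.
- case/sub_addsmxP => -[u1 u2] /= ->; apply: addmx_sub.
    have /XI_mxP[f Xf ->] : (u1 *m XI_mx U j <= XI_mx U j)%MS by apply: submxMl.
    by apply: vec_ker; apply: XI_ker Xf.
  have /IX_mxP[f Xf ->] : (u2 *m IX_mx U j <= IX_mx U j)%MS by apply: submxMl.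
  by apply: vec_ker; apply: IX_ker Xf.
- rewrite sub_capmx => /andP[/XI_mxP[f Xf Ef] /IX_mxP[g Xg Eg]].
  rewrite Ef -vec_hpart //; apply: vec_overlap.
  apply: (overlaps_decomposable d_gt0 x_deg phi_surj (tor3 _ bj)).
  + by rewrite hpart_hpart eqxx.
  + exact: XI_hpart.
  by rewrite -vecK // -Ef Eg vecK //; apply: IX_hpart.
move=> /overlap_mxP[f Of ->]; rewrite sub_capmx; apply/andP; split.
  by apply/XI_mxP; exists f => //; apply: overlap_XI Of.
by apply/IX_mxP; exists f => //; apply: overlap_IX Of.
Qed.

End MatrixPresentation.

(** * Finiteness *)

Section PolynomialSpaces.
Variables (k : fieldType) (P : comNzRingType) (T : Type) (ev : T -> {rmorphism P -> k}).
Variable S : set T.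
Local Notation poly U := (polynomial_space ev S U).

Lemma polynomial_space_eqmx l1 l2 m (U : T -> 'M[k]_(l1, m)) (V : T -> 'M[k]_(l2, m)) :
  (forall q, S q -> (U q :=: V q)%MS) -> poly V -> poly U.
Proof.
move=> UV [r [M HM]]; exists r, M => q Sq; exact: eqmx_trans (UV q Sq) (HM q Sq).
Qed.

Lemma polynomial_space_ev l m (M : 'M[P]_(l, m)) : poly (fun q => map_mx (ev q) M).
Proof. by exists l, M. Qed.

Lemma polynomial_space_add l1 l2 m (U : T -> 'M[k]_(l1, m)) (V : T -> 'M[k]_(l2, m)) :
  poly U -> poly V -> poly (fun q => U q + V q)%MS.
Proof.
move=> [r [M HM]] [r' [M' HM']]; exists (r + r')%N, (col_mx M M') => q Sq.
rewrite map_col_mx; apply: eqmx_trans (addsmxE _ _).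
exact: adds_eqmx (HM q Sq) (HM' q Sq).
Qed.

Lemma polynomial_space_sum (I : Type) (s : seq I) (Q : pred I) m (U : I -> T -> 'M[k]_m) :
  (forall i, Q i -> poly (U i)) -> poly (fun q => \sum_(i <- s | Q i) U i q)%MS.
Proof.
move=> H; elim: s => [|i s IH].
  exists 0%N, 0 => q Sq; rewrite big_nil; apply/eqmxP.
  apply/andP; split; first exact: sub0mx.
  by apply/row_subP => -[].
have [Qi|nQi] := boolP (Q i).
  apply: polynomial_space_eqmx (polynomial_space_add (H i Qi) IH) => q _.
  by rewrite big_cons Qi.
by apply: polynomial_space_eqmx IH => q _; rewrite big_cons (negPf nQi).
Qed.

Lemma polynomial_space_mul l m m' (U : T -> 'M[k]_(l, m)) (C : 'M[k]_(m, m')) (C' : 'M[P]_(m, m')) :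
  (forall q, map_mx (ev q) C' = C) -> poly U -> poly (fun q => U q *m C).
Proof.
move=> HC [r [M HM]]; exists r, (M *m C') => q Sq; rewrite map_mxM HC.
exact: eqmxMr (HM q Sq).
Qed.

Lemma polynomial_space_gen l m (U : T -> 'M[k]_(l, m)) : poly U -> poly (fun q => <<U q>>%MS).
Proof. by apply: polynomial_space_eqmx => q _; apply: genmxE. Qed.

Variables (n : nat) (d : 'I_n -> nat).
Local Notation N := (nwords d).

(** [prodmx] depends on row spaces only, so both factors may be replaced by their polynomial
    matrices. *)
Lemma polynomial_space_prod l1 l2 p q j (U : T -> 'M[k]_(l1, N p)) (V : T -> 'M[k]_(l2, N q)) :
  poly U -> poly V -> poly (fun t => prodmx j (U t) (V t)).
Proof.
move=> [r [M HM]] [r' [M' HM']].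
apply: (polynomial_space_eqmx (V := fun t => prodmx j (map_mx (ev t) M) (map_mx (ev t) M'))).
  by move=> t St; apply: prodmx_eqmx; [apply: HM|apply: HM'].
apply: polynomial_space_sum => s _; apply: polynomial_space_gen.
exists r', (M' *m conc q j (row s M)) => t _.
by rewrite map_mxM map_conc map_row.
Qed.

Variable U : T -> forall j, 'M[k]_(N j).

Lemma polynomial_space_XI j : (forall i, (d i <= j)%N -> poly (U^~ (j - d i)%N)) ->
  poly (fun q => XI_mx (U q) j).
Proof.
move=> H; apply: polynomial_space_sum => i dj; apply: polynomial_space_gen.
by apply: polynomial_space_mul (H i dj) => q; apply: map_lcat_mx.
Qed.

Lemma polynomial_space_IX j : (forall i, (d i <= j)%N -> poly (U^~ (j - d i)%N)) ->
  poly (fun q => IX_mx (U q) j).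
Proof.
move=> H; apply: polynomial_space_sum => i dj; apply: polynomial_space_gen.
by apply: polynomial_space_mul (H i dj) => q; apply: map_rcat_mx.
Qed.

Lemma polynomial_space_overlap j : (forall i, poly (U^~ i)) ->
  poly (fun q => overlap_mx (U q) j).
Proof.
move=> H; apply: polynomial_space_add; apply: polynomial_space_sum => i di.
  exact: polynomial_space_prod.
apply: polynomial_space_sum => i' di'; apply: polynomial_space_gen.
apply: polynomial_space_mul => [q|]; first exact: map_rcat_mx.
by apply: polynomial_space_mul (H _) => q; apply: map_lcat_mx.
Qed.

(** Above [b], each I_j is F_+ I + I F_+ in degree [j], built from lower components by constant
    matrices. By induction it is polynomial in the low-degree data. *)
Lemma polynomial_space_presents b : (forall i, (0 < d i)%N) ->
  (forall q, S q -> presents (U q) b) -> (forall j, (j <= b)%N -> poly (U^~ j)) ->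
  forall j, poly (U^~ j).
Proof.
move=> d0 pU low; elim/ltn_ind => j IH; have [|bj] := leqP j b; first exact: low.
have sub i : (d i <= j)%N -> poly (U^~ (j - d i)%N).
  by move=> dj; apply: IH; rewrite ltn_subrL d0 (leq_trans (d0 i) dj).
apply: polynomial_space_eqmx (polynomial_space_add (polynomial_space_XI sub) (polynomial_space_IX sub)).
by move=> q Sq; have [] := pU q Sq j bj.
Qed.

End PolynomialSpaces.

(** * Generic constancy of the Hilbert series *)

Section Finiteness.

(** On an infinite [S], the bound [r] is attained at all but finitely many points, so it is the
    maximum. *)
Definition generic_max (T : Type) (S : set T) (rho : T -> nat) :=
  exists r, (forall q, S q -> (rho q <= r)%N) /\ finite_set [set q | S q /\ (rho q < r)%N].

(* Above [b], an upper bound on [sigma] is a lower bound on [rho]. *)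
Lemma generic_constant (T : Type) (S : set T) (b n : nat) (d : 'I_n -> nat)
    (rho sigma : nat -> T -> nat) :
  infinite_set S -> (forall i, (0 < d i)%N) ->
  (forall j, generic_max S (rho j)) -> (forall j, generic_max S (sigma j)) ->
  (forall j q, (b < j)%N -> S q ->
    (rho j q + sigma j q = (\sum_(i | (d i <= j)%N) rho (j - d i)%N q).*2)%N) ->
  exists S', [/\ S' `<=` S, infinite_set S' &
    forall q q' j, S' q -> S' q' -> rho j q = rho j q'].
Proof.
move=> Sinf d0 /choice[r Hr] /choice[s Hs] rec.
pose B j := [set q | S q /\ (rho j q < r j)%N].
(* Only the degrees up to [b] cost points, finitely many each; all higher degrees are handled on
   this same set. *)
pose S' := S `\` \bigcup_(j in `I_b.+1) B j.
have S'inf : infinite_set S'.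
  apply: infinite_setD => //; apply: bigcup_finite; first exact: finite_II.
  by move=> j _; have [] := Hr j.
exists S'; split=> //; first by move=> q [].
suff E j : forall q, S' q -> rho j q = r j by move=> q q' j Sq Sq'; rewrite !E.
elim/ltn_ind: j => j IH q [Sq nB]; apply/eqP; rewrite eqn_leq (Hr j).1 //=.
have [jb|bj] := leqP j b.
  by rewrite leqNgt; apply/negP => lt; apply: nB; exists j.
have recS q1 : S' q1 -> (rho j q1 + sigma j q1 = (\sum_(i | (d i <= j)%N) r (j - d i)%N).*2)%N.
  move=> S'q1; rewrite rec //; last by case: S'q1.
  congr (_.*2); apply: eq_bigr => i dj; apply: IH => //.
  by rewrite ltn_subrL d0 (leq_trans (d0 i) dj).
(* [q0] is generic for both ranks in degree [j]. It may depend on [j], whereas [S'] does not. *)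
have [q0 [S'q0 nbad]] : exists q0, S' q0 /\
    ~ ((B j `|` [set q | S q /\ (sigma j q < s j)%N]) q0).
  have : infinite_set (S' `\` (B j `|` [set q | S q /\ (sigma j q < s j)%N])).
    by apply: infinite_setD => //; rewrite finite_setU; split; [have [] := Hr j|have [] := Hs j].
  by move=> /infinite_setN0[q0 []]; exists q0.
have Sq0 : S q0 by case: S'q0.
have r0 : (r j <= rho j q0)%N by rewrite leqNgt; apply/negP => lt; apply: nbad; left.
have s0 : (s j <= sigma j q0)%N by rewrite leqNgt; apply/negP => lt; apply: nbad; right.
(* Both points have the same sum of ranks, at least r j + s j at [q0]; as sigma is at most s j at
   [q], rho is at least r j there. *)
have E0 := recS _ S'q0; have E1 := recS q (conj Sq nB); have sq := (Hs j).1 q Sq.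
by move: E0 E1 r0 s0 sq; move: (_.*2) => C; lia.
Qed.

Variables (k : fieldType) (n : nat) (d : 'I_n -> nat) (d_gt0 : forall i, (0 < d i)%N).
Local Notation N := (nwords d).

(** The series themselves are the points of the parameter space, each with a chosen presentation.
    Constancy of all ranks on an infinite set of points is then absurd. *)
Lemma finite_presented_series b : finite_set [set h : nat -> nat |
  exists U : forall j, 'M[k]_(N j), presents U b /\ forall j, h j = (N j - \rank (U j))%N].
Proof.
apply: contrapT; set H := [set h | _] => Hinf.
have [U HU] : exists U : (nat -> nat) -> forall j, 'M[k]_(N j),
    forall h, H h -> presents (U h) b /\ forall j, h j = (N j - \rank (U h j))%N.
  have ex h : exists U : forall j, 'M[k]_(N j), H h ->
      presents U b /\ forall j, h j = (N j - \rank (U j))%N.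
    have [[U HU]|nH] := pselect (H h); first by exists U.
    by exists (fun=> 0) => /nH.
  by exists (fun h => sval (cid (ex h))) => h; apply: svalP (cid (ex h)).
(* The coordinates of a point are the entries of its matrices in degrees up to [b]. *)
pose Par : finType := {j : 'I_b.+1 & ('I_(N j) * 'I_(N j))%type}.
have [P [X [noethP evP]]] := polynomial_functions k Par.
pose par (h : nat -> nat) (p : Par) : k := U h (tag p) (tagged p).1 (tagged p).2.
have /choice[ev Hev] : forall h, exists ev : {rmorphism P -> k}, forall p, ev (X p) = par h p.
  by move=> h; apply: evP.
have [S [SH Sinf irr]] := exists_irreducible noethP ev Hinf.
have low j : (j <= b)%N -> polynomial_space ev S (U^~ j).
  rewrite -ltnS => jb.
  apply: (polynomial_space_eqmx (V := fun h => map_mx (ev h)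
    (\matrix_(s, t) X (Tagged (fun j : 'I_b.+1 => ('I_(N j) * 'I_(N j))%type) ((s, t) : 'I_(N (Ordinal jb)) * 'I_(N (Ordinal jb))))))).
    by move=> h _; rewrite [X in (_ :=: X)%MS](_ : _ = U h j) //; apply/matrixP => s t; rewrite !mxE Hev.
  exact: polynomial_space_ev.
have polyU := polynomial_space_presents d_gt0 (fun h Sh => (HU h (SH h Sh)).1) low.
have S0 : S !=set0 by apply: infinite_setN0.
have [|||S' [S'S S'inf const]] := @generic_constant _ S b n d
  (fun j h => \rank (U h j)) (fun j h => \rank (overlap_mx (U h) j)) Sinf d_gt0.
- by move=> j; apply: rank_generic S0 irr (polyU j).
- by move=> j; apply: rank_generic S0 irr (polynomial_space_overlap j polyU).
- by move=> j h bj Sh; apply: rank_presents bj => //; have [] := HU h (SH h Sh).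
have [h0 S'h0] := infinite_setN0 S'inf.
apply: S'inf; apply: (sub_finite_set (B := [set h0])); last exact: finite_set1.
move=> h S'h; apply/funext => j.
have [_ ->] := HU h (SH h (S'S h S'h)); have [_ ->] := HU h0 (SH h0 (S'S h0 S'h0)).
by rewrite (const h h0).
Qed.

End Finiteness.

(** The maximum of the three bounds dominates the degrees of the chosen generators and all degrees
    in which Tor_2 or Tor_3 is nonzero. *)
Lemma D_presents (k : fieldType) (n a b c : nat) (A : connGrAlg k) : (0 < a)%N ->
  D n a b c A -> exists d : 'I_n -> nat, (forall i, (0 < d i <= a)%N) /\
    exists U : forall j, 'M[k]_(nwords d j), presents U (maxn a (maxn b c)) /\
      forall j, hilbert_series A j = (nwords d j - \rank (U j))%N.
Proof.
move=> a0 [gens m1 m2 m3]; have [F] := freeAlgebra_exists k n.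
have [d [x [da xd surj]]] := exists_generators F a0 gens (fun j => m_bound m1).
have d0 i : (0 < d i)%N by have /andP[] := da i.
exists d; split=> //; have [U HU] := relation_mx F d x; exists U; split; last exact: hilbert_series_rank.
apply: (tor_presents d0 xd surj HU) => [i|j|j]; rewrite ?gtn_max.
- by rewrite leq_max; have /andP[_ ->] := da i.
- by move=> /and3P[_ bj _]; apply: m_bound m2 bj.
- by move=> /and3P[_ _ cj]; apply: m_bound m3 cj.
Qed.

Theorem theorem1p1 (k : fieldType) (n a b c : nat)
    (hn : (0 < n)%N) (ha : (0 < a)%N) (hb : (0 < b)%N) (hc : (0 < c)%N) :
  finite_set [set h : nat -> nat |
    exists2 A : connGrAlg k, D n a b c A & h = hilbert_series A].
Proof.
(* The degrees of the [n] generators lie between 1 and [a], so finitely many sequences of degrees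
   occur and each contributes finitely many series. *)
pose ok (d : {ffun 'I_n -> 'I_a.+1}) := forall i, (0 < d i)%N.
pose H (d : {ffun 'I_n -> 'I_a.+1}) := [set h : nat -> nat |
  exists U : forall j, 'M[k]_(nwords (fun i => d i : nat) j), presents U (maxn a (maxn b c)) /\
    forall j, h j = (nwords (fun i => d i : nat) j - \rank (U j))%N].
apply: (sub_finite_set (B := \bigcup_(d in [set d | ok d]) H d)).
  move=> h [A DA ->]; have [d [da HU]] := D_presents ha DA.
  have da' i : (d i < a.+1)%N by have /andP[_] := da i.
  exists [ffun i => Ordinal (da' i)].
    by move=> i; rewrite ffunE /=; have /andP[] := da i.
  rewrite /H (_ : (fun i => _) = d) //.
  by apply/funext => i; rewrite ffunE.
apply: bigcup_finite => [|d okd]; first exact: finite_finset.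
exact: finite_presented_series.
Qed.
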